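(* Let $G$ be the disjoint union of $n$ copies of the triangle $K_3$. Let $X$ be the number of crossings in a uniformly random embedding of $G$, and let $W=\frac{X-E(X)}{\sqrt{\mathrm{Var}(X)}}$. Then $$\mathrm{Var}(X)=\frac{3n^3}{5}+\frac{3n^2}{10}-\frac{9n}{10},$$ and $$d_K(W,Z)\le\frac{3620}{\sqrt n}\qquad\text{for all } n\ge 1,$$ where $Z$ is a standard normal random variable.
   Context: Let $G=(V,E)$ be a graph with vertex set $V=[N]=\{1,\dots,N\}$ (here $N=3n$). For a permutation $\pi\in S_N$, the embedding $G_\pi$ is the graph on $[N]$ in which $(\pi(v),\pi(w))$ is an edge if and only if $(v,w)\in E$. A crossing in $G_\pi$ is a quadruple $(a,b,c,d)$ of vertices with $(a,b),(c,d)\in E$ and $\pi(a)>\pi(c)>\pi(b)>\pi(d)$. A uniformly random embedding of $G$ is $G_\pi$ with $\pi$ uniformly random in $S_N$. The Kolmogorov distance between real random variables is $d_K(X,Y)=\sup_{x\in\mathbb{R}}|P(X\le x)-P(Y\le x)|$. *)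

(* Defs.v *)
From HB Require Import structures.
From mathcomp Require Import all_boot all_order all_algebra all_fingroup.
From mathcomp Require Import all_classical all_reals all_analysis.
From mathcomp Require Import measurable_realfun.

Set Implicit Arguments.
Unset Strict Implicit.
Unset Printing Implicit Defensive.

Import Order.TTheory GRing.Theory Num.Theory.
Import numFieldNormedType.Exports.

Local Open Scope classical_set_scope.
Local Open Scope ring_scope.

(** Graphs are given by their adjacency relation; the vertex set [N] is
    encoded as 'I_N = {0, ..., N - 1}. *)

Definition complete_graph (k : nat) : rel 'I_k := fun u v => u != v.
Arguments complete_graph : clear implicits.

Definition disjoint_copies (n : nat) (T : finType) (e : rel T) :
    rel ('I_n * T)%type :=
  fun u v => (u.1 == v.1) && e u.2 v.2.
Arguments disjoint_copies n {T} e.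

Definition graph_iso (T U : finType) (e : rel T) (e' : rel U) : Prop :=
  exists2 f : T -> U, bijective f & forall x y, e' (f x) (f y) = e x y.

(** Each pair of crossing edges corresponds to exactly one quadruple, since the
    inequalities fix the roles of the four endpoints. *)
Definition is_crossing (N : nat) (e : rel 'I_N) (s : 'S_N)
    (q : 'I_N * 'I_N * 'I_N * 'I_N) : bool :=
  let: (a, b, c, d) := q in
  [&& e a b, e c d, (s a > s c)%N, (s c > s b)%N & (s b > s d)%N].

Definition nb_crossings (N : nat) (e : rel 'I_N) (s : 'S_N) : nat :=
  #|is_crossing e s|.

(** Permutations carry the discrete sigma-algebra; [{perm T}] is an alias of
    [perm_type T], hence the copies. *)
HB.instance Definition _ (T : finType) :=
  isPointed.Build (perm_type T) (perm_one T).
HB.instance Definition _ (T : finType) := Pointed.copy {perm T} (perm_type T).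
HB.instance Definition _ (T : finType) :=
  @isMeasurable.Build default_measure_display (perm_type T)
    discrete_measurable discrete_measurable0
    discrete_measurableC discrete_measurableU.
HB.instance Definition _ (T : finType) := Measurable.copy {perm T} (perm_type T).

Section RandomVariables.
Context d (T : measurableType d) (R : realType) (P : probability T R).

Definition uniform_perm (N : nat) (s : {RV P >-> 'S_N}) : Prop :=
  forall p : 'S_N, distribution P s [set p] = (#|{perm 'I_N}|%:R^-1)%:E.

Definition crossingsRV (N : nat) (e : rel 'I_N) (s : {RV P >-> 'S_N}) : T -> R :=
  fun w => (nb_crossings e (s w))%:R.

Lemma measurable_crossingsRV N (e : rel 'I_N) (s : {RV P >-> 'S_N}) :
  measurable_fun setT (crossingsRV e s).
Proof.
have mf : measurable_fun [set: 'S_N] (fun p => (nb_crossings e p)%:R : R).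
  by [].
exact: (measurableT_comp mf (measurable_funPT s)).
Qed.

HB.instance Definition _ N (e : rel 'I_N) (s : {RV P >-> 'S_N}) :=
  isMeasurableFun.Build _ _ _ _ (crossingsRV e s) (measurable_crossingsRV e s).

(** When the variance is 0 this is the constant 0, as division by 0 yields 0. *)
Definition standardize (X : {RV P >-> R}) : T -> R :=
  fun w => (X w - fine 'E_P[X]) / Num.sqrt (fine 'V_P[X]).

Lemma measurable_standardize (X : {RV P >-> R}) :
  measurable_fun setT (standardize X).
Proof. by apply: measurable_funM => //; apply: measurable_funB. Qed.

HB.instance Definition _ (X : {RV P >-> R}) :=
  isMeasurableFun.Build _ _ _ _ (standardize X) (measurable_standardize X).

Definition standard_normal (Z : {RV P >-> R}) : Prop :=
  forall A : set R, measurable A -> distribution P Z A = normal_prob 0 1 A.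

End RandomVariables.

Definition kolmogorov_dist (R : realType) d (T : measurableType d)
    (P : probability T R) d' (T' : measurableType d') (P' : probability T' R)
    (X : {RV P >-> R}) (Y : {RV P' >-> R}) : \bar R :=
  ereal_sup [set `|cdf X x - cdf Y x|%E | x in [set: R]].

(* Main.v *)
Require Import Defs.
From HB Require Import structures.
From mathcomp Require Import all_boot all_order all_algebra all_fingroup.
From mathcomp Require Import all_classical all_reals all_analysis.
From mathcomp Require Import measurable_realfun zify ring lra.

Set Implicit Arguments.
Unset Strict Implicit.
Unset Printing Implicit Defensive.

Import Order.TTheory GRing.Theory Num.Theory.
Import numFieldNormedType.Exports.

Local Open Scope classical_set_scope.
Local Open Scope ring_scope.

(** The crossings of disjoint triangles form a U-statistic of order two: place
    the vertices at independent uniform positions of a grid, and the number of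
    crossings is the sum over pairs of triangles of a function of the positions
    of their vertices, which are independent from one triangle to another.  A
    configuration without ties, seen up to order, is a uniform permutation
    ([avg_configuration_approx]), and ties disappear as the grid is refined.
    Thus the variance and the distribution function for permutations are limits
    of those for independent positions.

    Variance.  By [ustat_variance] it is enough to know the second moment of the
    number of crossings of two triangles and that of its conditional mean given
    one of them.  The first is a count over the 720 orders of six points.  In
    the second, an edge contributes a function of the cyclic distance of its
    ends; by rotation invariance the three edges of a triangle contribute
    pairwise uncorrelated terms, and only the variance of [p (1 - p)] for [p]
    uniform in [[0, 1]] remains.

    Normal approximation ([ustat_berry_esseen]).  Resampling one triangle gives
    an exchangeable pair [(W, W')] for which the conditional mean of [W - W'],
    given the configuration, is [(W + Rem) / n]; here [Rem] is the degenerate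
    part of the U-statistic, of order [n ^ (-1/2)].  The
    solution [f] of the Stein equation [f' w = w f w + 1_(w <= z) - Phi z] has
    [f'] equal to a bounded nondecreasing function plus a bounded nonincreasing
    one; hence, with [D = W - W'], the difference between [D (f W - f W')] and
    [D ^ 2 f' W] is at most [D |D| (q W - q W')] for a bounded [q], and
    exchangeability makes the mean of this bound equal to twice that of [q W]
    times the conditional mean of [D |D|].  Consequently the Kolmogorov
    distance is controlled by [Rem] and by the fluctuations of the conditional
    means of [D ^ 2] and [D |D|] ([stein_exchangeable]), without any smoothing.
    Both conditional means are functions of independent triangles which change
    little when one triangle moves, so that their variances follow from
    [avg_sqr_bounded_diff].  All probabilities here are averages over finite
    sets. *)

(** * The standard normal distribution and the Stein equation *)

Section MeanValue.
Context {R : realType}.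
Implicit Types f df : R -> R.

Lemma mean_value f df (a b : R) : a <= b ->
  (forall x, a <= x <= b -> is_derive x 1 f (df x)) ->
  exists2 c, a <= c <= b & f b - f a = df c * (b - a).
Proof.
move=> ab fdf.
have [||c cab E] := @MVT_segment _ f df a b ab.
- by move=> x; rewrite in_itv/= => /andP[ax xb]; apply: fdf; rewrite !ltW.
- apply: derivable_within_continuous => x; rewrite in_itv/= => xab.
  by have [] := fdf x xab.
- by exists c => //; move: cab; rewrite in_itv.
Qed.

Lemma ge0_derive_le f df (a b : R) : a <= b ->
  (forall x, a <= x <= b -> is_derive x 1 f (df x)) ->
  (forall x, a <= x <= b -> 0 <= df x) -> f a <= f b.
Proof.
move=> ab fdf df0; have [c cab E] := mean_value ab fdf.
by rewrite -subr_ge0 E mulr_ge0 ?df0// subr_ge0.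
Qed.

End MeanValue.

Section GaussianDensity.
Context {R : realType}.
Implicit Types w x z : R.

Definition gauss_pdf x : R := normal_pdf 0 1 x.
Definition gauss_cdf x : R := fine (normal_prob 0 1 `]-oo, x] : \bar R).

Local Notation phi := gauss_pdf.
Local Notation Phi := gauss_cdf.

Lemma gauss_pdfE x : phi x = normal_peak 1 * expR (- (x ^+ 2 / 2)).
Proof.
rewrite /phi normal_pdfE ?oner_eq0//= /normal_fun subr0 expr1n.
by rewrite mulNr mulr2n.
Qed.

Lemma gauss_pdf_gt0 x : 0 < phi x.
Proof. by rewrite gauss_pdfE mulr_gt0 ?expR_gt0// normal_peak_gt0 ?oner_eq0. Qed.

Lemma gauss_pdf_neq0 x : phi x != 0.
Proof. by rewrite gt_eqF ?gauss_pdf_gt0. Qed.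

Lemma gauss_pdfN x : phi (- x) = phi x.
Proof. by rewrite !gauss_pdfE sqrrN. Qed.

Lemma gauss_pdf_le1 x : phi x <= 1.
Proof.
rewrite gauss_pdfE -[leRHS]mul1r ler_pM ?normal_peak_ge0 ?expR_ge0//.
- rewrite /normal_peak expr1n mul1r invf_le1; last first.
    by rewrite sqrtr_gt0 pmulrn_lgt0 ?pi_gt0.
  rewrite -[leLHS]sqrtr1 ler_wsqrtr// mulr2n.
  by have := pi_ge2 R; lra.
- by rewrite expR_le1 oppr_le0 divr_ge0 ?sqr_ge0.
Qed.

Lemma inv_gauss_pdf_le6 x : `|x| <= 1 -> (phi x)^-1 <= 6.
Proof.
move=> x1; rewrite gauss_pdfE invfM invrK expr1n mul1r.
have -> : (6 : R) = 3 * 2 by ring.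
apply: ler_pM => //; rewrite ?sqrtr_ge0 ?invr_ge0 ?expR_ge0//.
  have -> : (3 : R) = Num.sqrt (3 ^+ 2) by rewrite sqrtr_sqr ger0_norm.
  rewrite ler_wsqrtr// mulr2n.
  by have [/andP[_ ?] _] := pihalf_02_cos_pihalf R; lra.
have x21 : x ^+ 2 <= 1 by rewrite -real_normK ?num_real// exprn_ile1.
rewrite invf_ple ?posrE ?expR_gt0//.
by apply: le_trans (expR_ge1Dx _); lra.
Qed.

Global Instance is_derive_gauss_pdf x : is_derive x 1 phi (- x * phi x).
Proof.
have E y : (normal_peak 1 *: (expR \o (- (2^-1 *: (@id R ^+ 2))))) y = phi y.
  change (normal_peak 1 * expR (- (2^-1 * y ^+ 2)) = phi y).
  by rewrite gauss_pdfE [2^-1 * _]mulrC.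
have -> : phi = normal_peak 1 *: (expR \o (- (2^-1 *: (@id R ^+ 2)))).
  by apply/funext => y; rewrite E.
apply: is_derive_eq; rewrite E gauss_pdfE.
change (normal_peak 1 * (expR (- (2^-1 * x ^+ 2)) * - (2^-1 * (2 * x * 1))) =
  - x * (normal_peak 1 * expR (- (x ^+ 2 / 2)))).
by rewrite [2^-1 * (x ^+ 2)]mulrC; field.
Qed.

Lemma gauss_cdf_itv x : 0 <= Phi x <= 1.
Proof.
have h1 := probability_le1 (normal_prob 0 1 : probability _ R) (measurable_itv `]-oo, x]).
have h0 := measure_ge0 (normal_prob 0 1 : probability _ R) `]-oo, x].
rewrite /Phi -!lee_fin !fineK ?h0 ?h1//; exact: fin_num_measure.
Qed.

Global Instance is_derive_gauss_cdf x : is_derive x 1 Phi (phi x).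
Proof.
have [||||dF F'] := @continuous_FTC1 R phi -oo%O x (x + 1).
- by rewrite ltrDl.
- apply: integrableS (integrable_normal_pdf _ _) => //.
- exact: ltNyr.
- by apply: continuous_normal_pdf; rewrite oner_eq0.
- by split; [exact: dF | rewrite -derive1E -F'].
Qed.

Let idR : measurableTypeR R -> R := idfun.

#[local] HB.instance Definition _ :=
  @isMeasurableFun.Build _ _ _ _ idR (@measurable_id _ _ setT).

Let normalP : probability _ R := normal_prob 0 1.

Lemma gauss_cdf_cvgNy0 (eps : R) : 0 < eps ->
  exists a, forall x, x <= a -> Phi x < eps.
Proof.
move=> e0.
have /fine_cvg/cvgrPdist_lt/(_ _ e0)[M [_ hM]] :=
  @cvg_cdfNy0 _ _ R normalP (idR : {RV normalP >-> R}).
exists (M - 1) => x xM; have /andP[P0 _] := gauss_cdf_itv x.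
have := hM x; rewrite /= sub0r normrN.
rewrite (_ : fine _ = Phi x)// ger0_norm//; apply; lra.
Qed.

Lemma gauss_cdf_cvgy1 (eps : R) : 0 < eps ->
  exists a, forall x, a <= x -> 1 - Phi x < eps.
Proof.
move=> e0.
have /fine_cvg/cvgrPdist_lt/(_ _ e0)[M [_ hM]] :=
  @cvg_cdfy1 _ _ R normalP (idR : {RV normalP >-> R}).
exists (M + 1) => x xM; have /andP[_ P1] := gauss_cdf_itv x.
have := hM x; rewrite /=.
rewrite (_ : fine (cdf _ _) = Phi x)// ger0_norm ?subr_ge0//; apply; lra.
Qed.

End GaussianDensity.

Lemma is_derive_div {R : realType} (f g : R -> R) (x a b : R) : g x != 0 ->
  is_derive x 1 f a -> is_derive x 1 g b ->
  is_derive x 1 (fun y => f y / g y) ((a * g x - f x * b) / g x ^+ 2).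
Proof.
move=> gx0 df dg.
have -> : (fun y => f y / g y) = f * (fun y => (g y)^-1) by apply/funext.
have hV := is_deriveV gx0 dg.
apply: is_derive_eq.
change (f x * (- g x ^- 2 * b) + (g x)^-1 * a = (a * g x - f x * b) / g x ^+ 2).
by field.
Qed.

Lemma is_derive_idM {R : realType} (f : R -> R) (x a : R) :
  is_derive x 1 f a -> is_derive x 1 (fun y => y * f y) (f x + x * a).
Proof.
move=> df.
have -> : (fun y => y * f y) = id * f by apply/funext.
apply: is_derive_eq.
change (x * a + f x * 1 = f x + x * a).
by rewrite mulr1 addrC.
Qed.

Section MillsRatio.
Context {R : realType} (G : R -> R).
Hypothesis dG : forall x : R, is_derive x 1 G (gauss_pdf x).
Hypothesis G_cvgNy0 : forall eps : R, 0 < eps ->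
  exists a, forall x, x <= a -> `|G x| < eps.
Local Notation phi := (@gauss_pdf R).

(** As [G] tends to 0, the last hypothesis says that the lower limit of [r] at
    -oo is nonnegative; so is [r] itself, being nondecreasing. *)
Let ge0_of_nondecreasing (r dr : R -> R) (b : R) :
  (forall x, x <= b -> is_derive x 1 r (dr x)) ->
  (forall x, x <= b -> 0 <= dr x) ->
  (forall x, x <= b -> x < 0 -> - `|G x| - `|x|^-1 <= r x) -> 0 <= r b.
Proof.
move=> drr dr0 rlow; rewrite leNgt; apply/negP => rb.
have e0 : 0 < - r b / 2 by lra.
have [a Ga] := G_cvgNy0 e0.
pose t := - (`|a| + `|b| + 1 + (- r b / 2)^-1).
have i0 : 0 < (- r b / 2)^-1 by rewrite invr_gt0.
have [a0 b0] : 0 <= `|a| /\ 0 <= `|b| by split; exact: normr_ge0.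
have [aN bN] : - a <= `|a| /\ - b <= `|b| by split; rewrite lerNl lerNnormlW.
have tb : t <= b by rewrite /t; lra.
have ta : t <= a by rewrite /t; lra.
have t0 : t < 0 by rewrite /t; lra.
have it : `|t|^-1 <= - r b / 2.
  rewrite invf_ple ?posrE ?normr_gt0 ?lt_eqF// ltr0_norm// /t; lra.
have le : r t <= r b.
  apply: (@ge0_derive_le _ r dr) => // x /andP[_ xb]; first exact: drr.
  exact: dr0.
have := rlow t tb t0; have := Ga t ta; lra.
Qed.

(** The derivative of [G x + x phi x / (1 + x ^ 2)] is
    [2 phi x / (1 + x ^ 2) ^ 2]. *)
Lemma mills_lower w : 0 <= (1 + w ^+ 2) * G w + w * phi w.
Proof.
have p1 x : 0 < 1 + x ^+ 2 :> R by rewrite ltr_pwDl ?sqr_ge0.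
pose r x := G x + x * phi x / (1 + x ^+ 2).
pose dr x := 2 * phi x / (1 + x ^+ 2) ^+ 2.
have : 0 <= r w.
  apply: (@ge0_of_nondecreasing r dr) => [x _|x _|x _ x0].
  - have d2 : is_derive x 1 (fun y : R => 1 + y ^+ 2) (2 * x).
      have -> : (fun y : R => 1 + y ^+ 2) = cst 1 + (fun y : R => y * id y).
        by apply/funext.
      have d1 := is_derive_idM (is_derive_id x (1 : R)).
      apply: (is_derive_eq (is_deriveD (is_derive_cst (1 : R) x (1 : R)) d1)).
      by rewrite add0r mulr1 mulr_natl mulr2n.
    have x2 : 1 + x ^+ 2 != 0 by rewrite gt_eqF.
    have d3 := @is_derive_div _ (fun y => y * phi y)
      (fun y => 1 + y ^+ 2) x _ _ x2 (is_derive_idM (is_derive_gauss_pdf x)) d2.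
    apply: (is_derive_eq (is_deriveD (dG x) d3)).
    by rewrite /dr; field.
  - by rewrite mulr_ge0 ?invr_ge0 ?exprn_ge0 ?mulr_ge0// ltW ?gauss_pdf_gt0.
  - rewrite /r lerD//; first by rewrite lerNl -normrN ler_norm.
    rewrite ler_pdivlMr// ltr0_norm// invrN opprK.
    have := @gauss_pdf_le1 R x; have := @gauss_pdf_gt0 R x.
    set p := phi x => p0 p1'.
    have -> : x^-1 * (1 + x ^+ 2) = x^-1 + x by field; rewrite lt_eqF.
    have : x <= x * p by rewrite ler_nMr.
    have : x^-1 < 0 by rewrite invr_lt0.
    lra.
by move=> r0; have := mulr_ge0 (ltW (p1 w)) r0; rewrite /r mulrDr mulrCA mulfV ?mulr1// gt_eqF.
Qed.

(** The derivative of [- G x - phi x / x] is [phi x / x ^ 2]. *)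
Lemma mills_upper w : w < 0 -> - w * G w <= phi w.
Proof.
move=> w0.
pose r x := - G x - phi x / x.
pose dr x := phi x / x ^+ 2.
have : 0 <= r w.
  apply: (@ge0_of_nondecreasing r dr) => [x xw|x xw|x xw x0].
  - have xn0 : x != 0 by rewrite lt_eqF//; lra.
    have d1 := @is_derive_div _ phi id x _ _ xn0 (is_derive_gauss_pdf x) (is_derive_id x (1 : R)).
    apply: (is_derive_eq (is_deriveB (is_deriveN (dG x)) d1)).
    by rewrite /dr; field.
  - by rewrite divr_ge0 ?sqr_ge0// ltW ?gauss_pdf_gt0.
  - rewrite /r lerD ?lerN2 ?ler_norm// ltr0_norm// invrN.
    have := @gauss_pdf_gt0 R x.
    have : x^-1 < 0 by rewrite invr_lt0.
    nra.
have -> : r w = (phi w + w * G w) / - w by rewrite /r; field; rewrite lt_eqF.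
by rewrite pmulr_lge0 ?invr_gt0 ?oppr_gt0// mulNr; lra.
Qed.

Let phi_n0 := @gauss_pdf_neq0 R.

Lemma is_derive_mills (w : R) : is_derive w 1 (fun x => G x / phi x) (1 + w * (G w / phi w)).
Proof.
apply: (is_derive_eq (is_derive_div (phi_n0 w) (dG w) (is_derive_gauss_pdf w))).
by have p0 := phi_n0 w; field.
Qed.

(** The sign of the derivative is that of the quantity in [mills_lower]. *)
Lemma nondecreasing_mills x y : x <= y -> x * (G x / phi x) <= y * (G y / phi y).
Proof.
move=> xy.
apply: (@ge0_derive_le _ (fun x => x * (G x / phi x))
   (fun x => ((1 + x ^+ 2) * G x + x * phi x) / phi x)) => // z _; last first.
  by rewrite divr_ge0 ?mills_lower// ltW ?gauss_pdf_gt0.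
apply: (is_derive_eq (is_derive_idM (is_derive_mills z))).
by have p0 := phi_n0 z; field.
Qed.

End MillsRatio.

Section SteinSolution.
Context {R : realType}.
Local Notation phi := (@gauss_pdf R).
Local Notation Phi := (@gauss_cdf R).

(** The reflected tail [x |-> 1 - Phi (- x)] satisfies the same two hypotheses
    as [Phi], so that every estimate at -oo gives one at +oo. *)
Let Psi (x : R) := 1 - Phi (- x).

Let dPsi (x : R) : is_derive x 1 Psi (phi x).
Proof.
have d : is_derive x 1 (Phi \o -%R) (phi (- x) * - 1).
  by apply: is_derive1_comp.
have -> : Psi = cst 1 - (Phi \o -%R) by apply/funext.
apply: (is_derive_eq (is_deriveB (is_derive_cst (1 : R) x 1) d)).
by rewrite gauss_pdfN mulrN1 opprK add0r.
Qed.

Let Phi_Ny0 (eps : R) : 0 < eps -> exists a, forall x, x <= a -> `|Phi x| < eps.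
Proof.
move=> /gauss_cdf_cvgNy0[a ha]; exists a => x xa.
by rewrite ger0_norm ?ha//; have /andP[] := gauss_cdf_itv x.
Qed.

Let Psi_Ny0 (eps : R) : 0 < eps -> exists a, forall x, x <= a -> `|Psi x| < eps.
Proof.
move=> /gauss_cdf_cvgy1[a ha]; exists (- a) => x xa.
rewrite ger0_norm ?ha//; first by rewrite lerNr.
by rewrite subr_ge0; have /andP[] := gauss_cdf_itv (- x).
Qed.

(** The bounded solution of [f' w = w f w + 1_(w <= z) - Phi z], in closed form. *)
Definition stein_sol (z w : R) : R :=
  if w <= z then (1 - Phi z) * (Phi w / phi w)
  else Phi z * ((1 - Phi w) / phi w).

Lemma stein_solE z w : z <= w ->
  stein_sol z w = Phi z * ((1 - Phi w) / phi w).
Proof.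
rewrite le_eqVlt => /predU1P[<-|zw]; last by rewrite /stein_sol leNgt zw.
by rewrite /stein_sol lexx; ring.
Qed.

Let left_nondec (z x y : R) : x <= y -> y <= z ->
  x * stein_sol z x <= y * stein_sol z y.
Proof.
move=> xy yz; rewrite /stein_sol yz (le_trans xy yz).
rewrite !(mulrCA _ (1 - Phi z)) ler_wpM2l//.
  by rewrite subr_ge0; have /andP[] := gauss_cdf_itv z.
by apply: (nondecreasing_mills _ Phi_Ny0) => // t; exact: is_derive_gauss_cdf.
Qed.

Let right_nondec (z x y : R) : x <= y -> z <= x ->
  x * stein_sol z x <= y * stein_sol z y.
Proof.
move=> xy zx; rewrite !stein_solE//; last exact: le_trans xy.
rewrite !(mulrCA _ (Phi z)) ler_wpM2l//; first by have /andP[] := gauss_cdf_itv z.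
rewrite -lerN2.
have := @nondecreasing_mills _ _ dPsi Psi_Ny0 (- y) (- x).
by rewrite /Psi !opprK !gauss_pdfN !mulNr; apply; rewrite lerN2.
Qed.

Lemma stein_sol_nondecreasing (z x y : R) : x <= y ->
  x * stein_sol z x <= y * stein_sol z y.
Proof.
move=> xy; have [yz|zy] := leP y z; first exact: left_nondec.
have [xz|zx] := leP x z; last by apply: right_nondec => //; exact: ltW.
by apply: le_trans (left_nondec xz _) (right_nondec (ltW zy) _).
Qed.

(** By monotonicity it suffices to bound [w f w] for [w] far to the left of [z]
    and 0, and far to the right, where Mills' inequality applies. *)
Lemma stein_sol_bounded z w : `|w * stein_sol z w| <= 1.
Proof.
have /andP[P0 P1] := gauss_cdf_itv z.
rewrite ler_norml; apply/andP; split.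
- pose t := - (`|w| + `|z| + 1).
  have [w0 z0] : 0 <= `|w| /\ 0 <= `|z| by split; exact: normr_ge0.
  have [wN zN] : - w <= `|w| /\ - z <= `|z| by split; rewrite lerNl lerNnormlW.
  have tw : t <= w by rewrite /t; lra.
  apply: le_trans (stein_sol_nondecreasing z tw).
  rewrite /stein_sol ifT; last by rewrite /t; lra.
  have t0 : t < 0 by rewrite /t; lra.
  have h := mills_upper (@is_derive_gauss_cdf R) Phi_Ny0 t0.
  have {}h : - (t * (Phi t / phi t)) <= 1.
    by rewrite -mulNr mulrA ler_pdivrMr ?gauss_pdf_gt0// mul1r.
  move: h; set q := t * _ => h; rewrite mulrCA -/q; nra.
- pose t := `|w| + `|z| + 1.
  have [w0 z0] : 0 <= `|w| /\ 0 <= `|z| by split; exact: normr_ge0.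
  have [wN zN] : w <= `|w| /\ z <= `|z| by split; exact: ler_norm.
  have wt : w <= t by rewrite /t; lra.
  apply: le_trans (stein_sol_nondecreasing z wt) _.
  rewrite stein_solE; last by rewrite /t; lra.
  have t0 : - t < 0 by rewrite /t; lra.
  have h := mills_upper dPsi Psi_Ny0 t0.
  have {}h : t * ((1 - Phi t) / phi t) <= 1.
    rewrite mulrA ler_pdivrMr ?gauss_pdf_gt0// mul1r.
    by move: h; rewrite /Psi !opprK gauss_pdfN.
  move: h; set q := t * _ => h; rewrite mulrCA -/q; nra.
Qed.

(** For [1 <= `|w|] the previous bound is stronger; otherwise [f w] is at most
    [(phi w)^-1 <= sqrt (2 pi e) <= 6]. *)
Lemma stein_sol_le6 z w : `|stein_sol z w| <= 6.
Proof.
have /andP[P0 P1] := gauss_cdf_itv z; have /andP[Q0 Q1] := gauss_cdf_itv w.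
have [w1|w1] := leP `|w| 1; last first.
  apply: (@le_trans _ _ (`|w| * `|stein_sol z w|)).
    by rewrite ler_peMl// ltW.
  by rewrite -normrM (le_trans (stein_sol_bounded _ _))// ler1n.
apply: le_trans (inv_gauss_pdf_le6 w1).
rewrite /stein_sol; case: ifP => _; rewrite mulrA normrM;
  rewrite [X in _ * X]ger0_norm ?invr_ge0 ?(ltW (gauss_pdf_gt0 _))//;
  rewrite ler_piMl ?invr_ge0 ?(ltW (gauss_pdf_gt0 _))//;
  rewrite ger0_norm; nra.
Qed.

Let left_increment (z x y : R) : x <= y -> y <= z ->
  (y - x) * (x * stein_sol z x + 1 - Phi z) <= stein_sol z y - stein_sol z x /\
  stein_sol z y - stein_sol z x <= (y - x) * (y * stein_sol z y + 1 - Phi z).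
Proof.
move=> xy yz; have xz := le_trans xy yz.
have [|c /andP[xc cy]] := @mean_value _ (fun w => Phi w / phi w)
  (fun w => 1 + w * (Phi w / phi w)) x y xy.
  by move=> t _; apply: is_derive_mills; exact: is_derive_gauss_cdf.
move=> E.
have -> : stein_sol z y - stein_sol z x = (y - x) * (c * stein_sol z c + 1 - Phi z).
  rewrite /stein_sol xz yz (le_trans cy yz) -mulrBr E; ring.
split; apply: ler_wpM2l; rewrite ?subr_ge0// !lerD2r; exact: stein_sol_nondecreasing.
Qed.

Let right_increment (z x y : R) : x <= y -> z <= x ->
  (y - x) * (x * stein_sol z x - Phi z) <= stein_sol z y - stein_sol z x /\
  stein_sol z y - stein_sol z x <= (y - x) * (y * stein_sol z y - Phi z).
Proof.
move=> xy zx; have zy := le_trans zx xy.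
have [||c /andP[yc cx]] := @mean_value _ (fun w => Psi w / phi w)
  (fun w => 1 + w * (Psi w / phi w)) (- y) (- x).
- by rewrite lerN2.
- by move=> t _; exact: (is_derive_mills dPsi).
rewrite /Psi !opprK !gauss_pdfN => E.
have -> : stein_sol z y - stein_sol z x = (y - x) * (- c * stein_sol z (- c) - Phi z).
  rewrite !stein_solE//; last by rewrite lerNr (le_trans cx)// lerN2.
  rewrite gauss_pdfN -mulrBr -opprB E; ring.
split; apply: ler_wpM2l; rewrite ?subr_ge0// !lerD2r; apply: stein_sol_nondecreasing.
  by rewrite lerNr.
by rewrite lerNl.
Qed.

(** By the mean value theorem the slope is a value of
    [f' w = w f w + 1_(w <= z) - Phi z] on [[x, y]]; the first term is
    nondecreasing and the second nonincreasing. *)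
Lemma stein_sol_increment (z x y : R) : x <= y ->
  (y - x) * (x * stein_sol z x + (y <= z)%R%:R - Phi z)
    <= stein_sol z y - stein_sol z x /\
  stein_sol z y - stein_sol z x
    <= (y - x) * (y * stein_sol z y + (x <= z)%R%:R - Phi z).
Proof.
move=> xy; have yx0 : 0 <= y - x by rewrite subr_ge0.
have [yz|zy] := leP y z.
  by rewrite (le_trans xy yz); exact: left_increment.
have [xz|zx] := leP x z; last first.
  by rewrite !addr0; apply: right_increment => //; exact: ltW.
have [a b] := left_increment xz (lexx z).
have [c d] := right_increment (ltW zy) (lexx z).
have e := stein_sol_nondecreasing z xz.
have f := stein_sol_nondecreasing z (ltW zy).
have yz0 : 0 <= y - z by rewrite subr_ge0 ltW.
have zx0 : 0 <= z - x by rewrite subr_ge0.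
have e1 := ler_wpM2l yz0 e; have f1 := ler_wpM2l zx0 f.
rewrite /= mulr0n mulr1n; split; lra.
Qed.

End SteinSolution.

(** * Averages over finite types *)

Section Average.
Context {R : realFieldType}.
Implicit Types T U : finType.

Definition avg T (f : T -> R) : R := (\sum_x f x) / #|T|%:R.

Lemma sum_cst T (c : R) : \sum_(x : T) c = #|T|%:R * c.
Proof. by rewrite mulr_natl -sumr_const. Qed.

Lemma eq_avg T (f g : T -> R) : f =1 g -> avg f = avg g.
Proof. by move=> fg; rewrite /avg (eq_bigr g). Qed.

Lemma avgD T (f g : T -> R) : avg (fun x => f x + g x) = avg f + avg g.
Proof. by rewrite /avg big_split mulrDl. Qed.

Lemma avgN T (f : T -> R) : avg (fun x => - f x) = - avg f.
Proof. by rewrite /avg sumrN mulNr. Qed.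

Lemma avgB T (f g : T -> R) : avg (fun x => f x - g x) = avg f - avg g.
Proof. by rewrite avgD avgN. Qed.

Lemma avgZ T c (f : T -> R) : avg (fun x => c * f x) = c * avg f.
Proof. by rewrite /avg -mulr_sumr mulrA. Qed.

Lemma avgZr T c (f : T -> R) : avg (fun x => f x * c) = avg f * c.
Proof. by rewrite /avg -mulr_suml mulrAC. Qed.

Lemma avg_sum T (I : Type) (r : seq I) (P : pred I) (F : I -> T -> R) :
  avg (fun x => \sum_(i <- r | P i) F i x) = \sum_(i <- r | P i) avg (F i).
Proof. by rewrite /avg exchange_big mulr_suml. Qed.

Lemma exchange_avg T U (f : T -> U -> R) :
  avg (fun x => avg (f x)) = avg (fun y => avg (f^~ y)).
Proof.
rewrite /avg -2!mulr_suml exchange_big /= -!mulrA.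
by congr (_ * _); rewrite mulrC.
Qed.

Lemma avg_pair T U (f : T * U -> R) :
  avg f = avg (fun x => avg (fun y => f (x, y))).
Proof.
rewrite /avg card_prod natrM -mulr_suml pair_bigA/= -mulrA -invfM [X in _ / X]mulrC.
by congr (_ / _); apply: eq_bigr => -[].
Qed.

Lemma reindex_avg T U (h : U -> T) (f : T -> R) : bijective h ->
  avg f = avg (f \o h).
Proof.
by move=> hbij; rewrite /avg (reindex h)/= ?(bij_eq_card hbij)//; exact: onW_bij.
Qed.

Lemma ler_avg T (f g : T -> R) : (forall x, f x <= g x) -> avg f <= avg g.
Proof. by move=> fg; rewrite /avg ler_wpM2r ?invr_ge0// ler_sum. Qed.

Lemma avg_ge0 T (f : T -> R) : (forall x, 0 <= f x) -> 0 <= avg f.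
Proof. by move=> f0; rewrite /avg divr_ge0// sumr_ge0. Qed.

Lemma ler_norm_avg T (f : T -> R) : `|avg f| <= avg (fun x => `|f x|).
Proof.
by rewrite /avg normrM normfV normr_nat ler_wpM2r ?invr_ge0// ler_norm_sum.
Qed.

Lemma ler_norm_avgM T (f g : T -> R) c : (forall x, `|f x| <= c) ->
  `|avg (fun x => f x * g x)| <= c * avg (fun x => `|g x|).
Proof.
move=> fc; apply: le_trans (ler_norm_avg _) _.
by rewrite -avgZ; apply: ler_avg => x; rewrite normrM ler_wpM2r.
Qed.

Section NonEmpty.
Variable T : finType.
Hypothesis T0 : (0 < #|T|)%N.

Lemma avg_cst c : avg (fun _ : T => c) = c.
Proof.
by rewrite /avg sum_cst mulrC mulKf// pnatr_eq0 -lt0n.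
Qed.

Lemma avg_le (f : T -> R) c : (forall x, f x <= c) -> avg f <= c.
Proof. by move=> fc; rewrite -[leRHS]avg_cst; exact: ler_avg. Qed.

Lemma avg_sqr_ge0B (f : T -> R) :
  avg (fun x => (f x - avg f) ^+ 2) = avg (fun x => f x ^+ 2) - avg f ^+ 2.
Proof.
under eq_avg => x do rewrite sqrrB -[_ *+ 2]mulr_natr -addrA.
rewrite avgD; congr (_ + _).
by rewrite avgD avgN avgZr avg_cst avgZr; ring.
Qed.

End NonEmpty.

Lemma avg_cauchy_schwarz T (f g : T -> R) :
  avg (fun x => f x * g x) ^+ 2 <= avg (fun x => f x ^+ 2) * avg (fun x => g x ^+ 2).
Proof.
set a := avg (fun x => g x ^+ 2); set b := avg (fun x => f x * g x).
have a0 : 0 <= a by apply: avg_ge0 => x; exact: sqr_ge0.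
have key t : 0 <= avg (fun x => f x ^+ 2) - 2 * t * b + t ^+ 2 * a.
  rewrite /a /b -!avgZ -avgB -avgD; apply: avg_ge0 => x.
  by have := sqr_ge0 (f x - t * g x); nra.
move: a0; rewrite le_eqVlt => /predU1P[a0|a0].
  rewrite -a0 mulr0; have [->|b0] := eqVneq b 0; first by rewrite expr0n.
  (* a value of t for which the trinomial is negative *)
  have := key ((avg (fun x => f x ^+ 2) + 1) / b); rewrite -a0 mulr0 addr0.
  rewrite -mulrA divfK//.
  have : 0 <= avg (fun x => f x ^+ 2) by apply: avg_ge0 => x; exact: sqr_ge0.
  lra.
have := key (b / a).
have -> : 2 * (b / a) * b = 2 * (b ^+ 2 / a) by field; rewrite gt_eqF.
have -> : (b / a) ^+ 2 * a = b ^+ 2 / a by field; rewrite gt_eqF.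
by move=> h; rewrite -ler_pdivrMr//; lra.
Qed.

Lemma avg_norm_sqr T (T0 : (0 < #|T|)%N) (f : T -> R) :
  avg (fun x => `|f x|) ^+ 2 <= avg (fun x => f x ^+ 2).
Proof.
have := avg_cauchy_schwarz (fun x => `|f x|) (fun=> 1).
under eq_avg do rewrite mulr1.
rewrite expr1n avg_cst// mulr1.
by under [in leRHS]eq_avg do rewrite real_normK ?num_real//.
Qed.

End Average.

(** * Stein's method for a reversible pair *)

Section SteinExchangeable.
Context {R : realType} (Omega J : finType).
Hypothesis (Omega0 : (0 < #|Omega|)%N) (J0 : (0 < #|J|)%N).
Variables (step : Omega -> J -> Omega) (W Rem : Omega -> R) (lam : R).
Hypothesis lam0 : 0 < lam.
Hypothesis step_reversible : forall psi : Omega -> Omega -> R,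
  avg (fun w => avg (fun j => psi w (step w j))) =
  avg (fun w => avg (fun j => psi (step w j) w)).
Let D w j := W w - W (step w j).
Hypothesis linear_regression : forall w, avg (D w) = lam * (W w + Rem w).

(** Exchanging the two members of the pair changes the sign of [k D]. *)
Let avg_antisym (h : R -> R) (k : R -> R) : (forall x, k (- x) = - k x) ->
  avg (fun w => avg (fun j => k (D w j) * (h (W w) - h (W (step w j))))) =
  2 * avg (fun w => h (W w) * avg (fun j => k (D w j))).
Proof.
move=> kN.
have E : avg (fun w => avg (fun j => k (D w j) * h (W (step w j)))) =
    - avg (fun w => h (W w) * avg (fun j => k (D w j))).
  rewrite (step_reversible (fun w w' => k (W w - W w') * h (W w'))).
  rewrite -avgN; apply: eq_avg => w; rewrite -mulrN -avgN -avgZ; apply: eq_avg => j.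
  by rewrite -kN opprB mulrC.
under eq_avg => w do under eq_avg => j do rewrite mulrBr.
under eq_avg => w do rewrite avgB.
rewrite avgB E opprK.
under eq_avg => w do rewrite avgZr mulrC.
by ring.
Qed.

(** Write [E W f(W)] as [E D (f W - f W') / (2 lam)] up to the remainder.  With
    [q x = x f x - 1_(x <= z)], [stein_sol_increment] bounds the error in
    [D (f W - f W') ~ D ^ 2 f' W] by [D |D| (q W - q W')], whose mean is
    [2 E (q W . avg (D |D|))] because [D |D|] is antisymmetric. *)
Theorem stein_exchangeable z :
  `|avg (fun w => (W w <= z)%R%:R) - gauss_cdf z| <=
    2 * avg (fun w => `|1 - avg (fun j => D w j ^+ 2) / (2 * lam)|)
    + 2 / lam * avg (fun w => `|avg (fun j => D w j * `|D w j|)|)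
    + 6 * avg (fun w => `|Rem w|).
Proof.
pose f := @stein_sol R z.
pose g x := x * f x.
pose I (x : R) : R := (x <= z)%R%:R.
pose f' x := g x + I x - gauss_cdf z.
pose q x := g x - I x.
have /andP[P0 P1] := gauss_cdf_itv z.
have I01 x : 0 <= I x <= 1 by rewrite /I ler0n lern1 leq_b1.
have g1 x : -1 <= g x <= 1 by have := stein_sol_bounded z x; rewrite ler_norml.
have f'2 x : `|f' x| <= 2.
  have /andP[? ?] := I01 x; have /andP[? ?] := g1 x.
  by rewrite ler_norml /f'; apply/andP; split; lra.
have q2 x : `|q x| <= 2.
  have /andP[? ?] := I01 x; have /andP[? ?] := g1 x.
  by rewrite ler_norml /q; apply/andP; split; lra.
have f6 x : `|f x| <= 6 by exact: stein_sol_le6.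
have incr x y : `|(x - y) ^+ 2 * f' x - (x - y) * (f x - f y)| <=
    ((x - y) * `|x - y|) * (q x - q y).
  have [yx|xy] := leP y x.
    have [a b] := stein_sol_increment z yx.
    have c := stein_sol_nondecreasing z yx.
    have d0 : 0 <= x - y by rewrite subr_ge0.
    have i : I x <= I y.
      by rewrite /I ler_nat; case: (leP x z) => // xz; rewrite (le_trans yx xz).
    have -> : (x - y) ^+ 2 * f' x - (x - y) * (f x - f y) =
      (x - y) * ((x - y) * f' x - (f x - f y)) by ring.
    rewrite normrM (ger0_norm d0) -mulrA ler_wpM2l//.
    have e1 := ler_wpM2l d0 c; have e2 := ler_wpM2l d0 i.
    move: a b e1 e2; rewrite -/(f x) -/(f y) -/(g x) -/(g y) -/(I x) -/(I y).
    by move=> *; rewrite ler_norml /f' /q; apply/andP; split; lra.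
  have [a b] := stein_sol_increment z (ltW xy).
  have c := stein_sol_nondecreasing z (ltW xy).
  have d0 : 0 <= y - x by rewrite subr_ge0 ltW.
  have i : I y <= I x.
    by rewrite /I ler_nat; case: (leP y z) => // yz; rewrite (le_trans (ltW xy) yz).
  have -> : (x - y) ^+ 2 * f' x - (x - y) * (f x - f y) =
    (y - x) * ((y - x) * f' x - (f y - f x)) by ring.
  rewrite -(distrC y) (ger0_norm d0) normrM (ger0_norm d0).
  have -> : (x - y) * (y - x) * (q x - q y) = (y - x) * ((y - x) * (q y - q x)) by ring.
  rewrite ler_wpM2l//.
  have e1 := ler_wpM2l d0 c; have e2 := ler_wpM2l d0 i.
  move: a b e1 e2; rewrite -/(f x) -/(f y) -/(g x) -/(g y) -/(I x) -/(I y).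
  by move=> *; rewrite ler_norml /f' /q; apply/andP; split; lra.
have lin : avg (fun w => avg (fun j => D w j * (f (W w) - f (W (step w j))))) =
    2 * lam * (avg (fun w => g (W w)) + avg (fun w => f (W w) * Rem w)).
  rewrite (@avg_antisym f id)//.
  under eq_avg => w do rewrite linear_regression.
  rewrite -avgD -mulrA; congr (_ * _); rewrite -avgZ; apply: eq_avg => w.
  by rewrite /g; ring.
pose err := avg (fun w => avg (fun j =>
  D w j ^+ 2 * f' (W w) - D w j * (f (W w) - f (W (step w j))))).
have errE : err = avg (fun w => f' (W w) * avg (fun j => D w j ^+ 2)) -
    2 * lam * (avg (fun w => g (W w)) + avg (fun w => f (W w) * Rem w)).
  rewrite /err -lin -avgB; apply: eq_avg => w; rewrite avgB; congr (_ - _).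
  by rewrite avgZr mulrC.
have err_le : `|err| <= 4 * avg (fun w => `|avg (fun j => D w j * `|D w j|)|).
  apply: (@le_trans _ _ (avg (fun w => avg (fun j =>
      D w j * `|D w j| * (q (W w) - q (W (step w j))))))).
    apply: le_trans (ler_norm_avg _) _; apply: ler_avg => w.
    by apply: le_trans (ler_norm_avg _) _; apply: ler_avg => j; exact: incr.
  rewrite (@avg_antisym q (fun x => x * `|x|)); last first.
    by move=> x; rewrite normrN mulNr.
  have := @ler_norm_avgM _ _ (fun w => q (W w))
    (fun w => avg (fun j => D w j * `|D w j|)) 2 (fun w => q2 (W w)).
  rewrite ler_norml => /andP[_]; lra.
have E : avg (fun w => I (W w)) - gauss_cdf z =
    avg (fun w => f' (W w) * (1 - avg (fun j => D w j ^+ 2) / (2 * lam)))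
    + err / (2 * lam) + avg (fun w => f (W w) * Rem w).
  rewrite errE.
  under [in RHS]eq_avg => w do rewrite mulrBr mulr1 mulrA.
  rewrite avgB avgZr /f' avgB avgD avg_cst//; field.
  by rewrite gt_eqF.
rewrite -/(I _) E.
apply: le_trans (ler_normD _ _) _; apply: lerD; last exact: ler_norm_avgM.
apply: le_trans (ler_normD _ _) _; apply: lerD; first exact: ler_norm_avgM.
have lam2 : 0 < 2 * lam by rewrite mulr_gt0.
rewrite normrM normfV (gtr0_norm lam2) ler_pdivrMr//.
apply: le_trans err_le _; rewrite le_eqVlt; apply/orP; left; apply/eqP.
by field; rewrite gt_eqF.
Qed.

Let avg_le_L2 (f : Omega -> R) c : 0 <= c ->
  avg (fun w => f w ^+ 2) <= c ^+ 2 -> avg (fun w => `|f w|) <= c.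
Proof.
move=> c0 fc; rewrite -(@ler_pXn2r _ 2)// ?nnegrE ?avg_ge0//.
exact: le_trans (avg_norm_sqr Omega0 _) fc.
Qed.

(** The mean of [avg D ^ 2 / (2 lam)] is [1 + avg (W Rem)], hence only its
    fluctuations remain to be bounded. *)
Corollary stein_exchangeable_L2 z A B r : 0 <= A -> 0 <= B -> 0 <= r ->
  avg (fun w => W w ^+ 2) = 1 ->
  let K w := avg (fun j => D w j ^+ 2) in
  avg (fun w => (K w - avg K) ^+ 2) <= A ^+ 2 ->
  let Q w := avg (fun j => D w j * `|D w j|) in
  avg (fun w => (Q w - avg Q) ^+ 2) <= B ^+ 2 ->
  avg (fun w => Rem w ^+ 2) <= r ^+ 2 ->
  `|avg (fun w => (W w <= z)%R%:R) - gauss_cdf z| <= (A + 2 * B) / lam + 8 * r.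
Proof.
move=> A0 B0 r0 W1 K KA Q QB Rr.
have il0 : 0 < lam^-1 by rewrite invr_gt0.
have Rr1 : avg (fun w => `|Rem w|) <= r by exact: avg_le_L2.
have QB1 : avg (fun w => `|Q w|) <= B.
  apply: avg_le_L2 => //; suff Q0 : avg Q = 0.
    by move: QB; under eq_avg => w do rewrite Q0 subr0.
  have /eqP := @avg_antisym (fun=> 1) (fun x => x * `|x|)
    (fun x => etrans (congr1 (fun y => - x * y) (normrN x)) (mulNr _ _)).
  under eq_avg => w do under eq_avg => j do rewrite subrr mulr0.
  under eq_avg => w do rewrite avg_cst//.
  rewrite avg_cst// eq_sym mulf_eq0 pnatr_eq0/= => /eqP.
  by under eq_avg => w do rewrite mul1r.
have Kmean : avg K = 2 * lam * (1 + avg (fun w => W w * Rem w)).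
  have := @avg_antisym id id (fun=> erefl).
  under eq_avg => w do under eq_avg => j do rewrite -expr2.
  rewrite -/K => ->; rewrite -mulrA; congr (_ * _).
  rewrite -W1 -avgD -avgZ; apply: eq_avg => w.
  by rewrite linear_regression; ring.
have WR : `|avg (fun w => W w * Rem w)| <= r.
  rewrite -(@ler_pXn2r _ 2)// ?nnegrE// real_normK ?num_real//.
  apply: le_trans (avg_cauchy_schwarz _ _) _.
  by rewrite W1 mul1r.
have K1 : avg (fun w => `|1 - K w / (2 * lam)|) <= A / (2 * lam) + r.
  have KA1 : avg (fun w => `|K w - avg K|) <= A by exact: avg_le_L2.
  apply: (@le_trans _ _ (avg (fun w => `|K w - avg K| / (2 * lam) +
      `|avg (fun w => W w * Rem w)|))).
    apply: ler_avg => w.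
    have -> : 1 - K w / (2 * lam) = - ((K w - avg K) / (2 * lam)
        + avg (fun w => W w * Rem w)).
      by rewrite Kmean; field; rewrite gt_eqF.
    rewrite normrN (le_trans (ler_normD _ _))// lerD2r normrM normfV.
    by rewrite (@gtr0_norm _ (2 * lam)) ?mulr_gt0.
  rewrite avgD avgZr avg_cst// lerD// ler_wpM2r// invr_ge0 mulr_ge0//.
  exact: ltW.
apply: le_trans (stein_exchangeable z) _; rewrite -/K -/Q.
have -> : (A + 2 * B) / lam + 8 * r =
  2 * (A / (2 * lam) + r) + 2 / lam * B + 6 * r by field; rewrite gt_eqF.
apply: lerD; last by rewrite ler_wpM2l.
by apply: lerD; rewrite ler_wpM2l// mulr_ge0// ltW.
Qed.

End SteinExchangeable.

(** * Independent coordinates *)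

Section ProductSpace.
Context {R : realType} (I A : finType).
Hypothesis A0 : (0 < #|A|)%N.
Implicit Types (w : {ffun I -> A}) (i j : I) (a b : A).

Definition upd w i a : {ffun I -> A} := [ffun j => if j == i then a else w j].

Lemma card_ffun_gt0 : (0 < #|{ffun I -> A}|)%N.
Proof. by rewrite card_ffun expn_gt0 A0. Qed.

Lemma updE w i a j : upd w i a j = if j == i then a else w j.
Proof. by rewrite ffunE. Qed.

Lemma upd_same w i a : upd w i a i = a.
Proof. by rewrite ffunE eqxx. Qed.

Lemma upd_id w i : upd w i (w i) = w.
Proof. by apply/ffunP => j; rewrite ffunE; case: eqP => [->|]. Qed.

Lemma upd_upd w i a b : upd (upd w i a) i b = upd w i b.
Proof. by apply/ffunP => j; rewrite !ffunE; case: eqP. Qed.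

Lemma updC w i j a b : i != j -> upd (upd w i a) j b = upd (upd w j b) i a.
Proof.
move=> ij; apply/ffunP => l; rewrite !ffunE.
by case: (eqVneq l j) => [->|//]; rewrite eq_sym (negbTE ij).
Qed.

(** Exchanging the old and the new value of the coordinate is an involution. *)
Lemma avg_upd_reversible i (psi : {ffun I -> A} -> {ffun I -> A} -> R) :
  avg (fun w => avg (fun a => psi w (upd w i a))) =
  avg (fun w => avg (fun a => psi (upd w i a) w)).
Proof.
pose h (p : {ffun I -> A} * A) := (upd p.1 i p.2, p.1 i).
have hK : involutive h.
  by case=> w a; rewrite /h/= upd_same upd_upd upd_id.
have := @reindex_avg R _ _ h (fun p => psi p.1 (upd p.1 i p.2)) (inv_bij hK).
rewrite !avg_pair/= => ->; apply: eq_avg => w; apply: eq_avg => a.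
by rewrite upd_upd upd_id.
Qed.

Lemma avg_upd i (G : {ffun I -> A} -> R) :
  avg (fun w => avg (fun a => G (upd w i a))) = avg G.
Proof.
rewrite (avg_upd_reversible i (fun _ w' => G w')).
by apply: eq_avg => w; rewrite avg_cst.
Qed.

Lemma avg_coord i (f : A -> R) : avg (fun w => f (w i)) = avg f.
Proof.
rewrite -(avg_upd i).
under eq_avg => w do under eq_avg => a do rewrite upd_same.
by rewrite avg_cst//; exact: card_ffun_gt0.
Qed.

Lemma avg_coord2 i j (f : A -> A -> R) : i != j ->
  avg (fun w => f (w i) (w j)) = avg (fun a => avg (fun b => f a b)).
Proof.
move=> ij; rewrite -(avg_upd j).
under eq_avg => w do under eq_avg => a do rewrite upd_same updE (negbTE ij).
by rewrite (avg_coord i (fun a => avg (f a))).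
Qed.

Lemma upd_inv_cst (G : {ffun I -> A} -> R) :
  (forall w i a, G (upd w i a) = G w) -> forall w w', G w = G w'.
Proof.
move=> Gi w w'.
pose mix (s : seq I) : {ffun I -> A} := [ffun j => if j \in s then w' j else w j].
have Gmix s : G (mix s) = G w.
  elim: s => [|x s <-]; first by congr G; apply/ffunP => j; rewrite ffunE.
  rewrite -(Gi (mix s) x (w' x)); congr G; apply/ffunP => j.
  by rewrite !ffunE in_cons; case: eqP => [->|].
rewrite -(Gmix (enum I)); congr G; apply/ffunP => j.
by rewrite ffunE mem_enum.
Qed.

(** Averaging out the coordinates one at a time is a sequence of orthogonal
    projections, each of which costs at most [c ^+ 2]. *)
Lemma avg_sqr_bounded_diff (c : R) (G : {ffun I -> A} -> R) : 0 <= c ->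
  (forall w i a, `|G (upd w i a) - G w| <= c) ->
  avg (fun w => (G w - avg G) ^+ 2) <= #|I|%:R * c ^+ 2.
Proof.
move=> c0 Gc; rewrite avg_sqr_ge0B ?card_ffun_gt0// cardE.
have : forall i a w, i \notin enum I -> G (upd w i a) = G w.
  by move=> i a w; rewrite mem_enum.
elim: (enum I) G Gc => [|i s IH] G Gc Gs.
  have Gw := upd_inv_cst (fun w i a => Gs i a w isT).
  have [w0 _] : exists w0 : {ffun I -> A}, w0 \in {ffun I -> A}.
    exact/card_gt0P/card_ffun_gt0.
  under eq_avg => w do rewrite (Gw w w0).
  under [avg G]eq_avg => w do rewrite (Gw w w0).
  by rewrite !avg_cst ?card_ffun_gt0// subrr mul0r.
pose G1 w := avg (fun a => G (upd w i a)).
have G1i w a : G1 (upd w i a) = G1 w.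
  by apply: eq_avg => b; rewrite upd_upd.
have G1j w j a : j != i ->
    G1 (upd w j a) - G1 w = avg (fun b => G (upd (upd w i b) j a) - G (upd w i b)).
  by move=> ji; rewrite avgB; congr (_ - _); apply: eq_avg => b; rewrite updC.
have IH1 : avg (fun w => G1 w ^+ 2) - avg G1 ^+ 2 <= (size s)%:R * c ^+ 2.
  apply: IH => [w j a|j a w js].
    have [->|ji] := eqVneq j i; first by rewrite G1i subrr normr0.
    by rewrite G1j// (le_trans (ler_norm_avg _))// avg_le.
  have [->|ji] := eqVneq j i; first by rewrite G1i.
  apply/eqP; rewrite -subr_eq0 G1j//.
  under eq_avg => b do rewrite Gs ?subrr ?in_cons ?negb_or ?ji//.
  by rewrite avg_cst.
have avgG1 : avg G1 = avg G by exact: avg_upd.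
have G1G : avg (fun w => G1 w * G w) = avg (fun w => G1 w ^+ 2).
  rewrite -(avg_upd i); apply: eq_avg => w.
  by under eq_avg => a do rewrite G1i; rewrite avgZ expr2.
have GG1 w : `|G w - G1 w| <= c.
  have -> : G w - G1 w = avg (fun a => G w - G (upd w i a)).
    by rewrite avgB avg_cst.
  rewrite (le_trans (ler_norm_avg _))// avg_le// => a.
  by rewrite distrC.
have pyth : avg (fun w => (G w - G1 w) ^+ 2) =
    avg (fun w => G w ^+ 2) - avg (fun w => G1 w ^+ 2).
  transitivity (avg (fun w => G w ^+ 2 - 2 * (G1 w * G w) + G1 w ^+ 2)).
    by apply: eq_avg => w; ring.
  by rewrite avgD avgB avgZ G1G; ring.
have : avg (fun w => (G w - G1 w) ^+ 2) <= c ^+ 2.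
  apply: avg_le => [|w]; first exact: card_ffun_gt0.
  by rewrite -[leLHS]real_normK ?num_real// lerXn2r ?nnegrE.
move: IH1; rewrite pyth avgG1 /= -[(size s).+1]addn1 natrD mulrDl mul1r; lra.
Qed.

End ProductSpace.

(** * Degenerate and non-degenerate U-statistics of order two *)

Section UStatistic.
Context {R : realType} (I A : finType).
Hypothesis A0 : (0 < #|A|)%N.

Definition ustat (k : A -> A -> R) (w : {ffun I -> A}) : R :=
  \sum_i \sum_(j | j != i) k (w i) (w j).

Local Notation n := (#|I|%:R : R).

Lemma sum_neq_cst (i : I) (c : R) : \sum_(j | j != i) c = (n - 1) * c.
Proof.
have := @sum_cst R I c; rewrite (bigD1 i)//= => h.
by apply: (addrI c); rewrite h; ring.
Qed.

Lemma avg_ustat k : avg (ustat k) = n * (n - 1) * avg (fun a => avg (k a)).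
Proof.
rewrite /ustat avg_sum.
under eq_bigr => i _.
  rewrite avg_sum.
  under eq_bigr => j ji do rewrite (@avg_coord2 _ _ _ A0 i j) 1?eq_sym//.
  rewrite sum_neq_cst.
  over.
by rewrite sum_cst mulrA.
Qed.

Section Centered.
Variable k : A -> A -> R.
Hypothesis kC : forall a b, k a b = k b a.
Hypothesis k0 : avg (fun a => avg (k a)) = 0.
Let g a := avg (k a).

Let g0 : avg g = 0 := k0.

Let avg_kk (i j l m : I) : i != j -> l != m ->
  avg (fun w : {ffun I -> A} => k (w i) (w j) * k (w l) (w m)) =
  if (l == i) && (m == j) || (l == j) && (m == i)
  then avg (fun a => avg (fun b => k a b ^+ 2))
  else if (l == i) || (l == j) || (m == i) || (m == j)
  then avg (fun a => g a ^+ 2) else 0.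
Proof.
move=> ij lm.
have share (x y z : I) : x != y -> x != z -> y != z ->
    avg (fun w : {ffun I -> A} => k (w x) (w y) * k (w x) (w z)) = avg (fun a => g a ^+ 2).
  move=> xy xz yz; rewrite -(avg_upd A0 z).
  under eq_avg => w.
    under eq_avg => a do rewrite upd_same !updE (negbTE xz) (negbTE yz).
    rewrite avgZ -/(g _).
    over.
  rewrite -(avg_upd A0 y).
  under eq_avg => w.
    under eq_avg => a do rewrite upd_same !updE (negbTE xy).
    rewrite avgZr -/(g _).
    over.
  by rewrite (@avg_coord _ _ _ A0 x (fun a => g a * g a)).
have [li|li] := eqVneq l i.
  subst l; have [mj|mj] := eqVneq m j.
    subst m; rewrite /=; rewrite -(@avg_coord2 _ _ _ A0 i j (fun a b => k a b ^+ 2) ij).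
    by apply: eq_avg => w; rewrite expr2.
  rewrite /= (negbTE ij)/=; apply: share => //; by rewrite eq_sym.
have [lj|lj] := eqVneq l j.
  subst l; have [mi|mi] := eqVneq m i.
    subst m; rewrite /=; rewrite -(@avg_coord2 _ _ _ A0 i j (fun a b => k a b ^+ 2) ij).
    by apply: eq_avg => w; rewrite (kC (w j)) expr2.
  rewrite /=; under eq_avg => w do rewrite (kC (w i)).
  by apply: share => //; rewrite eq_sym.
have [mi|mi] := eqVneq m i.
  subst m; rewrite /=; under eq_avg => w do rewrite (kC (w l)).
  by apply: share => //; rewrite eq_sym.
have [mj|mj] := eqVneq m j.
  subst m; rewrite /=; under eq_avg => w do rewrite (kC (w l)) (kC (w i)).
  by apply: share => //; rewrite eq_sym.
rewrite /= -(avg_upd A0 m).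
have [im jm] : i != m /\ j != m by rewrite ![_ == m]eq_sym.
under eq_avg => w.
  under eq_avg => a do rewrite upd_same !updE (negbTE lm) (negbTE im) (negbTE jm).
  rewrite avgZ -/(g _).
  over.
rewrite -(avg_upd A0 l).
have [il jl] : i != l /\ j != l by rewrite ![_ == l]eq_sym.
under eq_avg => w.
  under eq_avg => a do rewrite upd_same !updE (negbTE il) (negbTE jl).
  rewrite avgZ g0 mulr0.
  over.
by rewrite avg_cst ?card_ffun_gt0.
Qed.

(** Two kernel terms are correlated only if they share an index; for a given
    pair there are 2 terms with the same two indices and [4 (n - 2)] terms with
    exactly one index in common. *)
Lemma avg_ustat_sqr :
  avg (fun w => ustat k w ^+ 2) =
  2 * n * (n - 1) * avg (fun a => avg (fun b => k a b ^+ 2))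
  + 4 * n * (n - 1) * (n - 2) * avg (fun a => g a ^+ 2).
Proof.
set v := avg (fun a => avg _); set s := avg (fun a => g a ^+ 2).
have sum_neq2 (i j : I) (c : R) : i != j ->
    \sum_(l | (l != i) && (l != j)) c = (n - 2) * c.
  move=> ij; have := sum_neq_cst i c; rewrite (bigD1 j) 1?eq_sym//= => h.
  by apply: (addrI c); rewrite h; ring.
have inner (i j : I) : i != j -> avg (fun w : {ffun I -> A} => k (w i) (w j) * ustat k w) =
    2 * v + 4 * (n - 2) * s.
  move=> ij; have ji : j != i by rewrite eq_sym.
  rewrite /ustat; under eq_avg => w do rewrite mulr_sumr.
  rewrite avg_sum.
  have E l : avg (fun w : {ffun I -> A} => k (w i) (w j) * (\sum_(m | m != l) k (w l) (w m))) =
     \sum_(m | m != l) (if (l == i) && (m == j) || (l == j) && (m == i) then v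
       else if (l == i) || (l == j) || (m == i) || (m == j) then s else 0).
    under eq_avg => w do rewrite mulr_sumr.
    rewrite avg_sum; apply: eq_bigr => m ml; rewrite avg_kk// eq_sym//.
  under eq_bigr => l _ do rewrite E.
  have Ei : \sum_(m | m != i) (if (i == i) && (m == j) || (i == j) && (m == i) then v
       else if (i == i) || (i == j) || (m == i) || (m == j) then s else 0)
     = v + (n - 2) * s.
    rewrite (bigD1 j)//= !eqxx/=; congr (_ + _).
    rewrite -(sum_neq2 i j s ij); apply: eq_bigr => m /andP[mi mj].
    by rewrite (negbTE mj) (negbTE ij).
  have Ej : \sum_(m | m != j) (if (j == i) && (m == j) || (j == j) && (m == i) then v
       else if (j == i) || (j == j) || (m == i) || (m == j) then s else 0)
     = v + (n - 2) * s.
    rewrite (bigD1 i)//= !eqxx/= (negbTE ji)/=; congr (_ + _).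
    rewrite -(sum_neq2 j i s ji); apply: eq_bigr => m /andP[mj mi].
    by rewrite (negbTE mi).
  rewrite (bigD1 i)//= Ei (bigD1 j)//= Ej.
  have -> : \sum_(l | (l != i) && (l != j)) \sum_(m | m != l)
      (if (l == i) && (m == j) || (l == j) && (m == i) then v
       else if (l == i) || (l == j) || (m == i) || (m == j) then s else 0)
      = (n - 2) * (2 * s).
    rewrite -(sum_neq2 i j _ ij); apply: eq_bigr => l /andP[li lj].
    rewrite (negbTE li) (negbTE lj)/=.
    rewrite (bigD1 i) 1?eq_sym//= eqxx (bigD1 j)/=; last by rewrite ji eq_sym lj.
    rewrite (negbTE ji) eqxx/= big1 ?addr0; first by ring.
    by move=> m /andP[/andP[_ mi] mj]; rewrite (negbTE mi) (negbTE mj).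
  by ring.
under eq_avg => w do rewrite expr2 {1}/ustat mulr_suml.
rewrite avg_sum.
under eq_bigr => i _.
  under eq_avg => w do rewrite mulr_suml.
  rewrite avg_sum.
  under eq_bigr => j ji do rewrite inner 1?eq_sym//.
  rewrite sum_neq_cst.
  over.
rewrite sum_cst; ring.
Qed.

End Centered.
End UStatistic.

Section UStatisticNormalApproximation.
Context {R : realType} (I A : finType).
Hypotheses (I0 : (0 < #|I|)%N) (A0 : (0 < #|A|)%N).
Variables (k : A -> A -> R) (H : R).
Hypothesis kC : forall a b, k a b = k b a.
Hypothesis k_osc : forall a b a' b', `|k a b - k a' b'| <= H.
Local Notation n := (#|I|%:R : R).
Local Notation Omega := {ffun I -> A}.

Let n0 : 0 < n. Proof. by rewrite ltr0n. Qed.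

Let H0 : 0 <= H.
Proof.
by have /card_gt0P[a _] := A0; have := k_osc a a a a; rewrite subrr normr0.
Qed.

Let increment (w : Omega) (p : I * A) := ustat k w - ustat k (upd w p.1 p.2).

Let incrementE w i a :
  increment w (i, a) = 2 * \sum_(j | j != i) (k (w i) (w j) - k a (w j)).
Proof.
have split_at (v : Omega) : ustat k v = 2 * (\sum_(j | j != i) k (v i) (v j)) +
    \sum_(l | l != i) \sum_(j | (j != l) && (j != i)) k (v l) (v j).
  rewrite /ustat (bigD1 i)//= mulr_natl mulr2n -addrA; congr (_ + _).
  rewrite -big_split/=; apply: eq_bigr => l li.
  by rewrite (bigD1 i) 1?eq_sym//= kC.
rewrite /increment !split_at/= sumrB mulrBr upd_same.
have -> : \sum_(j | j != i) k a (upd w i a j) = \sum_(j | j != i) k a (w j).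
  by apply: eq_bigr => j ji; rewrite updE (negbTE ji).
have -> : \sum_(l | l != i) \sum_(j | (j != l) && (j != i))
    k (upd w i a l) (upd w i a j) =
    \sum_(l | l != i) \sum_(j | (j != l) && (j != i)) k (w l) (w j).
  apply: eq_bigr => l li; apply: eq_bigr => j /andP[jl ji].
  by rewrite !updE (negbTE li) (negbTE ji).
ring.
Qed.

Let increment_le w p : `|increment w p| <= 2 * n * H.
Proof.
case: p => i a; rewrite incrementE normrM ger0_norm// -mulrA ler_wpM2l//.
apply: le_trans (ler_norm_sum _ _ _) _.
apply: (@le_trans _ _ (\sum_(j | j != i) H)); first by apply: ler_sum.
by rewrite sum_neq_cst mulrBl mul1r gerBl.
Qed.

Let increment_updB w l b p : `|increment (upd w l b) p - increment w p| <=
  4 * H + (p.1 == l)%:R * (4 * n * H).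
Proof.
case: p => i a /=; have [_|il] := eqVneq i l.
  rewrite mul1r (le_trans (ler_normB _ _))//.
  have := increment_le (upd w l b) (i, a); have := increment_le w (i, a).
  by have := H0; lra.
rewrite mul0r addr0 !incrementE updE (negbTE il) -mulrBr -sumrB.
rewrite (bigD1 l) 1?eq_sym//= big1 ?addr0; last first.
  by move=> j /andP[ji jl]; rewrite !updE (negbTE jl) subrr.
rewrite upd_same normrM ger0_norm// (_ : 4 = 2 * 2); last by ring.
rewrite -mulrA ler_wpM2l// (le_trans (ler_normB _ _))//.
have := k_osc (w i) b a b; have := k_osc (w i) (w l) a (w l); lra.
Qed.

Let avg_eq (l : I) : avg (fun i : I => (i == l)%:R) = n^-1 :> R.
Proof.
by rewrite /avg (bigD1 l)//= eqxx big1 ?addr0 ?mul1r// => i /negbTE->.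
Qed.

(** Both functionals of the increment in the normal approximation are averages
    of a function [t] with [t' = O(id)]; resampling one more coordinate changes
    one increment by [O(n)] and the others by [O(1)]. *)
Let functional_bounded_diff (t : R -> R) w l b :
  (forall x y, `|t x - t y| <= (`|x| + `|y|) * `|x - y|) ->
  `|avg (fun p => t (increment (upd w l b) p)) - avg (fun p => t (increment w p))|
    <= 32 * n * H ^+ 2.
Proof.
move=> tL; rewrite -avgB (le_trans (ler_norm_avg _))//.
have IA0 : (0 < #|{: I * A}|)%N by rewrite card_prod muln_gt0 I0.
apply: (@le_trans _ _ (avg (fun p : I * A =>
    (4 * n * H) * (4 * H + (p.1 == l)%:R * (4 * n * H))))).
  apply: ler_avg => p; apply: le_trans (tL _ _) _.
  have incr := increment_updB w l b p; apply: ler_pM => //.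
  by have := increment_le (upd w l b) p; have := increment_le w p; lra.
rewrite avgZ avgD avg_cst// avgZr avg_pair/=.
under [avg (fun x : I => _)]eq_avg => i do rewrite avg_cst//.
rewrite avg_eq le_eqVlt; apply/orP; left; apply/eqP.
by field; rewrite gt_eqF.
Qed.

Section Centered.
Hypothesis k0 : avg (fun a => avg (k a)) = 0.
Let g a := avg (k a).
Let k2 a b := k a b - g a - g b.

Let k_le a b : `|k a b| <= H.
Proof.
have -> : k a b = avg (fun a' => avg (fun b' => k a b - k a' b')).
  under eq_avg => a' do rewrite avgB avg_cst//.
  by rewrite avgB avg_cst// k0 subr0.
apply: le_trans (ler_norm_avg _) _; apply: avg_le => // a'.
by apply: le_trans (ler_norm_avg _) _; apply: avg_le.
Qed.

(** The kernel [k2] has zero mean in each argument, so that its U-statistic has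
    variance of order [n ^ 2] only. *)
Let avg_degenerate_part_sqr :
  avg (fun w : Omega => ustat k2 w ^+ 2) <= 18 * n ^+ 2 * H ^+ 2.
Proof.
have gr a : avg (k2 a) = 0.
  rewrite /k2 avgB avgB avg_cst// -/(g a).
  have -> : avg (fun x => g x) = 0 by exact: k0.
  by rewrite subrr subr0.
have g_le a : `|g a| <= H.
  by apply: le_trans (ler_norm_avg _) _; apply: avg_le.
have k2_le a b : k2 a b ^+ 2 <= 9 * H ^+ 2.
  have -> : 9 * H ^+ 2 = (3 * H) ^+ 2 by ring.
  rewrite -[leLHS]real_normK ?num_real// lerXn2r ?nnegrE ?mulr_ge0//.
  rewrite /k2 (le_trans (ler_normB _ _))//.
  have := ler_normB (k a b) (g a); have := k_le a b; have := g_le a.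
  by have := g_le b; lra.
rewrite (@avg_ustat_sqr R I A A0); first last.
- by under eq_avg => a do rewrite gr; exact: avg_cst.
- by move=> a b; rewrite /k2 kC; ring.
under [X in _ + _ * X]eq_avg => a do rewrite gr expr0n/=.
rewrite avg_cst// mulr0 addr0.
have v9 : avg (fun a => avg (fun b => k2 a b ^+ 2)) <= 9 * H ^+ 2.
  by apply: avg_le => // a; apply: avg_le.
have v0 : 0 <= avg (fun a => avg (fun b => k2 a b ^+ 2)).
  by apply: avg_ge0 => a; apply: avg_ge0 => b; exact: sqr_ge0.
have n1 : 1 <= n by rewrite ler1n.
have := sqr_ge0 H; set v := avg _ in v9 v0 *; move=> H2.
apply: (@le_trans _ _ (2 * n ^+ 2 * v)); first by nra.
by rewrite (_ : 18 = 2 * 9); [rewrite -!mulrA !ler_wpM2l ?sqr_ge0// ; nra | ring].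
Qed.

Variable s : R.
Hypothesis s0 : 0 < s.
Hypothesis sE : avg (fun w : Omega => ustat k w ^+ 2) = s ^+ 2.

(** Summing over the resampled index, the linear part of the U-statistic is
    counted once and the degenerate part twice. *)
Let regression (w : Omega) :
  avg (fun p : I * A => ustat k w / s - ustat k (upd w p.1 p.2) / s) =
  n^-1 * (ustat k w / s + ustat k2 w / s).
Proof.
have sum_sym (h : I -> R) : \sum_i \sum_(j | j != i) h j = \sum_i \sum_(j | j != i) h i.
  rewrite [RHS](exchange_big_dep predT)//=; apply: eq_bigr => i _.
  by apply: eq_bigl => j; rewrite eq_sym.
under eq_avg => p do rewrite -mulrBl.
rewrite avgZr -[X in _ = _ * X]mulrDl mulrA; congr (_ / _).
rewrite avg_pair -/increment /=.
rewrite /avg mulrC; congr (_ * _).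
transitivity (\sum_i \sum_(j | j != i) 2 * (k (w i) (w j) - g (w j))).
  apply: eq_bigr => i _; rewrite -/(avg _).
  under eq_avg => a do rewrite -/(increment w (i, a)) incrementE.
  rewrite avgZ avg_sum mulr_sumr; apply: eq_bigr => j ji.
  rewrite avgB avg_cst//; congr (_ * (_ - _)).
  by apply: eq_avg => a; rewrite kC.
have -> : \sum_i \sum_(j | j != i) 2 * (k (w i) (w j) - g (w j)) =
    2 * (ustat k w - \sum_i \sum_(j | j != i) g (w j)).
  rewrite /ustat -sumrB mulr_sumr; apply: eq_bigr => i _.
  by rewrite -sumrB mulr_sumr.
have -> : ustat k2 w = ustat k w - \sum_i \sum_(j | j != i) g (w i) -
    \sum_i \sum_(j | j != i) g (w j).
  by rewrite /ustat -!sumrB; apply: eq_bigr => i _; rewrite -!sumrB.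
rewrite -(sum_sym (fun i => g (w i))); ring.
Qed.

(** In the constant, [96 = 32 + 2 * 32] comes from the fluctuations of the two
    functionals of the increment and [40 = 8 * 5] from the degenerate part. *)
Lemma centered_ustat_berry_esseen kappa z : 0 < kappa -> kappa <= H ^+ 2 ->
  kappa * n ^+ 3 <= s ^+ 2 ->
  `|avg (fun w : Omega => (ustat k w / s <= z)%R%:R) - gauss_cdf z| <=
  136 * H ^+ 2 / (kappa * Num.sqrt n).
Proof.
move=> kap0 kapH kaps.
have Omega0 := @card_ffun_gt0 I _ A0.
have IA0 : (0 < #|{: I * A}|)%N by rewrite card_prod muln_gt0 I0.
have rev (psi : Omega -> Omega -> R) :
    avg (fun w => avg (fun p : I * A => psi w (upd w p.1 p.2))) =
    avg (fun w => avg (fun p : I * A => psi (upd w p.1 p.2) w)).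
  rewrite exchange_avg [RHS]exchange_avg !avg_pair; apply: eq_avg => i /=.
  rewrite exchange_avg [RHS]exchange_avg; exact: avg_upd_reversible.
have in0 : 0 < n^-1 by rewrite invr_gt0.
set q := Num.sqrt n.
have q0 : 0 < q by rewrite sqrtr_gt0.
have q2 : q ^+ 2 = n by rewrite sqr_sqrtr ?ltW.
pose K (t : R -> R) (w : Omega) :=
  avg (fun p : I * A => t (ustat k w / s - ustat k (upd w p.1 p.2) / s)).
have fluct (t : R -> R) :
    (forall x y, `|t x - t y| <= (`|x| + `|y|) * `|x - y|) ->
    (forall x, t (x / s) = t x / s ^+ 2) ->
    avg (fun w => (K t w - avg (K t)) ^+ 2) <= (q * (32 * n * H ^+ 2 / s ^+ 2)) ^+ 2.
  move=> tL ts; rewrite exprMn q2; apply: avg_sqr_bounded_diff => //.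
    by rewrite divr_ge0 ?sqr_ge0// mulr_ge0 ?sqr_ge0// mulr_ge0// ltW.
  move=> w l b; rewrite /K.
  under [X in X - _]eq_avg => p do rewrite -mulrBl ts.
  under [X in _ - X]eq_avg => p do rewrite -mulrBl ts.
  rewrite !avgZr -mulrBl normrM normfV (@ger0_norm _ (s ^+ 2)) ?sqr_ge0//.
  rewrite ler_wpM2r ?invr_ge0 ?sqr_ge0//.
  exact: functional_bounded_diff.
have sq_lip x y : `|x ^+ 2 - y ^+ 2| <= (`|x| + `|y|) * `|x - y| :> R.
  by rewrite subr_sqr normrM mulrC ler_wpM2r// ler_normD.
have sabs_lip x y : `|x * `|x| - y * `|y| | <= (`|x| + `|y|) * `|x - y| :> R.
  have -> : x * `|x| - y * `|y| = `|x| * (x - y) + y * (`|x| - `|y|) by ring.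
  rewrite (le_trans (ler_normD _ _))// !normrM normr_id mulrDl lerD2l ler_wpM2l//.
  exact: ler_dist_dist.
have rA := fluct (fun x => x ^+ 2) sq_lip (fun x => expr_div_n x s 2).
have sabs_hom x : x / s * `|x / s| = x * `|x| / s ^+ 2.
  rewrite normrM normfV (gtr0_norm s0); field; by rewrite gt_eqF.
have rB := fluct (fun x => x * `|x|) sabs_lip sabs_hom.
have W1 : avg (fun w : Omega => (ustat k w / s) ^+ 2) = 1.
  under eq_avg => w do rewrite expr_div_n.
  by rewrite avgZr sE divff// expf_neq0// gt_eqF.
have c0 : 0 <= q * (32 * n * H ^+ 2 / s ^+ 2).
  rewrite mulr_ge0 ?(ltW q0)//.
  by rewrite divr_ge0 ?sqr_ge0// mulr_ge0 ?sqr_ge0// mulr_ge0// ltW.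
have r0 : 0 <= 5 * H ^+ 2 / (kappa * q).
  by rewrite divr_ge0 ?mulr_ge0 ?sqr_ge0// ltW.
have kn0 : 0 < kappa * n ^+ 3 by rewrite mulr_gt0 ?exprn_gt0.
have s20 : 0 < s ^+ 2 by rewrite exprn_gt0.
have rR : avg (fun w : Omega => (ustat k2 w / s) ^+ 2) <= (5 * H ^+ 2 / (kappa * q)) ^+ 2.
  under eq_avg => w do rewrite expr_div_n.
  rewrite avgZr ler_pdivrMr//.
  apply: le_trans avg_degenerate_part_sqr _.
  apply: (@le_trans _ _ ((5 * H ^+ 2 / (kappa * q)) ^+ 2 * (kappa * n ^+ 3))); last first.
    by rewrite ler_wpM2l ?sqr_ge0.
  have -> : (5 * H ^+ 2 / (kappa * q)) ^+ 2 * (kappa * n ^+ 3) =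
      25 * n ^+ 2 * (H ^+ 2 * (H ^+ 2 / kappa)).
    rewrite expr_div_n exprMn [in RHS]exprS !exprMn q2; field.
    by rewrite !gt_eqF.
  have h1 : 1 <= H ^+ 2 / kappa by rewrite ler_pdivlMr// mul1r.
  have h2 : H ^+ 2 <= H ^+ 2 * (H ^+ 2 / kappa) by rewrite ler_peMr ?sqr_ge0.
  have h3 : 0 <= n ^+ 2 * H ^+ 2 by rewrite mulr_ge0 ?sqr_ge0.
  have h4 := ler_wpM2l (sqr_ge0 n) h2; lra.
apply: le_trans (@stein_exchangeable_L2 R Omega _ Omega0 IA0
  (fun w p => upd w p.1 p.2) (fun w => ustat k w / s) (fun w => ustat k2 w / s)
  n^-1 in0 rev regression z _ _ _ c0 c0 r0 W1 rA rB rR) _.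
have -> : (q * (32 * n * H ^+ 2 / s ^+ 2) + 2 * (q * (32 * n * H ^+ 2 / s ^+ 2))) / n^-1 =
    96 * H ^+ 2 * (n ^+ 2 * q) / s ^+ 2.
  by field; rewrite gt_eqF//= gt_eqF.
have -> : 136 * H ^+ 2 / (kappa * q) =
    96 * H ^+ 2 / (kappa * q) + 8 * (5 * H ^+ 2 / (kappa * q)) by ring.
rewrite lerD2r.
have -> : 96 * H ^+ 2 / (kappa * q) = 96 * H ^+ 2 * (n ^+ 2 * q) / (kappa * n ^+ 3).
  have -> : n ^+ 3 = n ^+ 2 * (q * q) by rewrite -expr2 q2 -exprSr.
  by field; rewrite !gt_eqF.
rewrite ler_wpM2l ?lef_pV2 ?posrE//.
by rewrite !mulr_ge0// ?sqr_ge0// ltW.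
Qed.

End Centered.

End UStatisticNormalApproximation.

Section UStatisticRecentering.
Context {R : realType} (I A : finType).
Hypothesis A0 : (0 < #|A|)%N.
Variable k : A -> A -> R.
Hypothesis kC : forall a b, k a b = k b a.
Local Notation n := (#|I|%:R : R).
Local Notation U := (@ustat R I A k).
Local Notation theta := (avg (fun a => avg (k a))).

Let ustat_recenter w : U w - avg U = ustat (fun a b => k a b - theta) w.
Proof.
rewrite avg_ustat// /ustat.
under [RHS]eq_bigr => i _ do rewrite sumrB sum_neq_cst.
by rewrite sumrB sum_cst [in RHS]mulrA.
Qed.

Let recenter0 : avg (fun a => avg (fun b => k a b - theta)) = 0.
Proof.
under eq_avg => a do rewrite avgB avg_cst//.
by rewrite avgB avg_cst// subrr.
Qed.

Lemma ustat_variance :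
  avg (fun w => (U w - avg U) ^+ 2) =
  2 * n * (n - 1) * (avg (fun a => avg (fun b => k a b ^+ 2)) - theta ^+ 2)
  + 4 * n * (n - 1) * (n - 2) * (avg (fun a => avg (k a) ^+ 2) - theta ^+ 2).
Proof.
under eq_avg => w do rewrite ustat_recenter.
rewrite avg_ustat_sqr//; last by move=> a b; rewrite kC.
congr (_ * _ + _ * _).
  have AA0 : (0 < #|{: A * A}|)%N by rewrite card_prod muln_gt0 A0.
  by have := avg_sqr_ge0B AA0 (fun p : A * A => k p.1 p.2); rewrite !avg_pair.
under eq_avg => a do rewrite avgB avg_cst//.
by rewrite -avg_sqr_ge0B.
Qed.

(** The hypothesis on the variance, which is of order [n ^ 3], excludes kernels
    that are nearly degenerate. *)
Theorem ustat_berry_esseen (H s kappa z : R) : (0 < #|I|)%N ->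
  (forall a b a' b', `|k a b - k a' b'| <= H) -> 0 < s ->
  avg (fun w => (U w - avg U) ^+ 2) = s ^+ 2 ->
  0 < kappa -> kappa <= H ^+ 2 -> kappa * n ^+ 3 <= s ^+ 2 ->
  `|avg (fun w => ((U w - avg U) / s <= z)%R%:R) - gauss_cdf z|
    <= 136 * H ^+ 2 / (kappa * Num.sqrt n).
Proof.
move=> I0 k_osc s0 sE kap0 kapH kaps.
under eq_avg => w do rewrite ustat_recenter.
apply: (@centered_ustat_berry_esseen R I A I0 A0 _ H) => //.
- by move=> a b; rewrite kC.
- move=> a b a' b'; set t := theta.
  by rewrite (_ : _ - _ = k a b - k a' b'); [exact: k_osc | ring].
- by under eq_avg => w do rewrite -ustat_recenter.
Qed.

End UStatisticRecentering.

(** * Crossings of two triangles *)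

Lemma big_ord3 (V : Type) (idx : V) (op : Monoid.law idx) (f : 'I_3 -> V) :
  \big[op/idx]_(i < 3) f i = op (f 0) (op (f 1) (f 2)).
Proof.
rewrite !big_ord_recl big_ord0 Monoid.mulm1.
by congr (op (f _) (op (f _) (f _))); apply: val_inj.
Qed.

Definition triangle_cross (S T : 'I_3 -> nat) : nat :=
  (\sum_k \sum_l \sum_k' \sum_l' [&& T k' < S k, S l < T k' & T l' < S l])%N.

Definition triangle_crossings (S T : 'I_3 -> nat) : nat :=
  (triangle_cross S T + triangle_cross T S)%N.

Lemma triangle_crossingsC S T : triangle_crossings S T = triangle_crossings T S.
Proof. exact: addnC. Qed.

(** Four endpoints in strictly decreasing positions cannot lie on one triangle. *)
Lemma triangle_cross_self (S : 'I_3 -> nat) : triangle_cross S S = 0%N.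
Proof.
rewrite /triangle_cross; apply: big1 => a _; apply: big1 => b _.
apply: big1 => c _; apply: big1 => d _.
apply/eqP; rewrite eqb0; apply/negP => /and3P[h1 h2 h3].
have := max_card (mem [:: a; c; b; d]).
rewrite card_ord (card_uniqP _)//=.
have neq (u v : 'I_3) : S u != S v -> u != v by apply: contra_neq => ->.
by rewrite !inE !negb_or !andbT !neq//; lia.
Qed.

(** The edge of [S] with endpoints in positions [b < a] is crossed once by every
    pair of vertices of [T] of which one is between [b] and [a] and the other
    is outside. *)
Lemma triangle_crossingsE (S T : 'I_3 -> nat) : triangle_crossings S T =
  (\sum_k \sum_l (\sum_k' (S l < T k' < S k)) *
     (\sum_l' ((T l' < S l) + (S k < T l'))))%N.
Proof.
rewrite /triangle_crossings; have -> : triangle_cross T S =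
    (\sum_k \sum_l \sum_k' \sum_l' [&& S k < T l', T k' < S k & S l < T k'])%N.
  rewrite /triangle_cross exchange_big/= [LHS]pair_bigA [RHS]pair_bigA/=.
  under eq_bigr => p _ do rewrite pair_bigA.
  by rewrite exchange_big/=; apply: eq_bigr => q _; rewrite pair_bigA.
rewrite /triangle_cross -big_split; apply: eq_bigr => k _.
rewrite -big_split; apply: eq_bigr => l _ /=.
rewrite -big_split big_distrl; apply: eq_bigr => k' _ /=.
rewrite -big_split big_distrr; apply: eq_bigr => l' _ /=.
by case: (ltnP (S l)); case: (ltnP (T k')); case: (ltnP (T l')); case: (ltnP (S k)).
Qed.

Lemma triangle_crossings_le6 (S T : 'I_3 -> nat) : (triangle_crossings S T <= 6)%N.
Proof.
rewrite triangle_crossingsE.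
have edge a b : ((\sum_(k : 'I_3) (b < T k < a)) *
    (\sum_(l : 'I_3) ((T l < b) + (a < T l))) <= 2 * (b < a))%N.
  have [ba|ab] := ltnP b a; last first.
    by rewrite big1// => k _; apply/eqP; rewrite eqb0; lia.
  set x := (\sum_(k < 3) _)%N; set y := (\sum_(l < 3) _)%N.
  have : (x + y <= 3)%N.
    rewrite /x /y -big_split/= -[leqRHS]card_ord -sum1_card; apply: leq_sum => k _.
    by case: (ltnP b); case: (ltnP (T k)); case: (ltnP (T k) b);
      case: (ltnP a (T k)) => /=; lia.
  by move: x y => [|[|[|[|x]]]] [|[|[|[|y]]]]; lia.
apply: (@leq_trans (\sum_k \sum_l 2 * (S l < S k)))%N.
  by apply: leq_sum => k _; apply: leq_sum => l _; exact: edge.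
rewrite !big_ord_recl !big_ord0 /=.
by case: ltngtP; case: ltngtP; case: ltngtP; lia.
Qed.

Section RandomTriangles.
Context {R : realType} (m : nat).
Local Notation M := m.+2.
Local Notation A := {ffun 'I_3 -> 'I_m.+2}.
Implicit Types (S T : A) (x y t : 'I_m.+2).

(** Half the number of crossings, since a U-statistic sums over ordered pairs. *)
Definition triangle_kernel S T : R :=
  (triangle_crossings (fun k => S k) (fun k => T k))%:R / 2.

Lemma triangle_kernelC S T : triangle_kernel S T = triangle_kernel T S.
Proof. by rewrite /triangle_kernel triangle_crossingsC. Qed.

Lemma triangle_kernel_osc S T S' T' :
  `|triangle_kernel S T - triangle_kernel S' T'| <= 3.
Proof.
have k03 U V : 0 <= triangle_kernel U V <= 3.
  rewrite /triangle_kernel divr_ge0//= ler_pdivrMr// -natrM ler_nat.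
  exact: triangle_crossings_le6.
have /andP[a b] := k03 S T; have /andP[c d] := k03 S' T'.
by rewrite ler_norml; apply/andP; split; lra.
Qed.

(** Given two positions at cyclic distance [d], this is the probability that, of
    two independent uniform positions, the first is strictly between them and
    the second strictly outside.  Truncated subtraction makes it 0 at [d = 0]. *)
Definition crossing_prob (d : 'I_m.+2) : R := (d.-1 * (m.+1 - d))%:R / M%:R ^+ 2.

Lemma card_ord_between (a b : nat) : (a <= M)%N ->
  (\sum_(t < M) (b < t < a) = a - b.+1)%N.
Proof.
move=> aM; suff h N : (\sum_(0 <= t < N) (b < t < a) = minn a N - b.+1)%N.
  by have := h M; rewrite big_mkord (minn_idPl aM).
elim: N => [|N IH]; first by rewrite big_geq// minn0.
by rewrite big_nat_recr//= IH; lia.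
Qed.

Lemma card_ord_outside (a b : nat) : (a < M)%N -> (b <= M)%N ->
  (\sum_(t < M) ((t < b) + (a < t)) = b + (M - a.+1))%N.
Proof.
move=> aM bM; suff h N : (\sum_(0 <= t < N) ((t < b) + (a < t)) = minn b N + (N - a.+1))%N.
  by have := h M; rewrite big_mkord (minn_idPl bM).
elim: N => [|N IH]; first by rewrite big_geq// minn0.
by rewrite big_nat_recr//= IH; lia.
Qed.

Lemma crossing_prob_sub x y : crossing_prob (x - y) =
  ((x - y.+1) * (y + (M - x.+1)) + (y - x.+1) * (x + (M - y.+1)))%N%:R / M%:R ^+ 2.
Proof.
rewrite /crossing_prob; congr (_%:R / _).
have [xM yM] := (ltn_ord x, ltn_ord y).
have xyE : nat_of_ord (x - y) = ((x + (M - y)) %% M)%N by rewrite /= modnDmr.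
have [yx|yx] := leqP y x; rewrite xyE.
  have -> : ((x + (M - y)) %% M)%N = (x - y)%N.
    have -> : (x + (M - y))%N = (x - y + M)%N by lia.
    by rewrite modnDr modn_small//; lia.
  have -> : (y - x.+1)%N = 0%N by lia.
  by rewrite mul0n addn0; congr (_ * _)%N; lia.
rewrite modn_small; last by lia.
have -> : (x - y.+1)%N = 0%N by lia.
by rewrite mul0n add0n mulnC; congr (_ * _)%N; lia.
Qed.

Lemma crossing_probC x y : crossing_prob (x - y) = crossing_prob (y - x).
Proof. by rewrite !crossing_prob_sub addnC. Qed.

Definition mean_crossing_prob : R := avg crossing_prob.
Definition mean_sqr_crossing_prob : R := avg (fun d => crossing_prob d ^+ 2).

Let Mgt0 : (0 < #|'I_m.+2|)%N. Proof. by rewrite card_ord. Qed.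

Let avg_sub x (f : 'I_m.+2 -> R) : avg (fun y => f (x - y)) = avg f.
Proof.
rewrite [RHS](@reindex_avg _ _ _ (fun y => x - y))//.
by apply: inv_bij => y; rewrite opprB addrCA subrr addr0.
Qed.

Let avg_edge_crossings x y :
  avg (fun T : A => ((\sum_k (y < T k < x)) * (\sum_l ((T l < y) + (x < T l))))%N%:R) =
  6 * (((x - y.+1) * (y + (M - x.+1)))%N%:R / M%:R ^+ 2) :> R.
Proof.
pose inside t : R := (y < t < x)%N%:R.
pose outside t : R := ((t < y) + (x < t))%N%:R.
have avg_inside : avg inside = (x - y.+1)%N%:R / M%:R.
  by rewrite /avg card_ord -natr_sum card_ord_between// ltnW.
have avg_outside : avg outside = (y + (M - x.+1))%N%:R / M%:R.
  by rewrite /avg card_ord -natr_sum card_ord_outside// ltnW.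
have disjoint t : inside t * outside t = 0.
  rewrite /inside /outside -natrM.
  by case: (ltnP y t); case: (ltnP t x); case: (ltnP t y); case: (ltnP x t) => //=; lia.
have expand (T : A) :
    ((\sum_k (y < T k < x)) * (\sum_l ((T l < y) + (x < T l))))%N%:R =
    \sum_k \sum_l inside (T k) * outside (T l).
  rewrite natrM !natr_sum mulr_suml; apply: eq_bigr => k _.
  by rewrite mulr_sumr.
under eq_avg => T do rewrite expand.
rewrite avg_sum; under eq_bigr => k _.
  rewrite avg_sum (bigD1 k)//=.
  under eq_avg => T do rewrite disjoint.
  rewrite avg_cst; last exact: card_ffun_gt0.
  under eq_bigr => l lk.
    rewrite (@avg_coord2 _ _ _ Mgt0 k l (fun a b => inside a * outside b)) 1?eq_sym//.
    under eq_avg => a do rewrite avgZ.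
    rewrite avgZr avg_inside avg_outside.
    over.
  rewrite sum_neq_cst add0r card_ord.
  over.
have : M%:R != 0 :> R by rewrite pnatr_eq0.
by rewrite sum_cst card_ord natrM; move: (M%:R) => r r0; field.
Qed.

(** The factor 3 counts the choices of the vertices of [T] inside and outside:
    there are 6 ordered pairs, and the kernel carries a factor 1/2. *)
Lemma avg_triangle_kernel S : avg (triangle_kernel S) =
  3 * (crossing_prob (S 0 - S 1) + crossing_prob (S 0 - S 2) + crossing_prob (S 1 - S 2)).
Proof.
rewrite /triangle_kernel avgZr.
under eq_avg => T.
  rewrite triangle_crossingsE natr_sum.
  under eq_bigr => k _ do rewrite natr_sum.
  over.
rewrite avg_sum; under eq_bigr => k _.
  rewrite avg_sum; under eq_bigr => l _ do rewrite avg_edge_crossings.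
  over.
rewrite !big_ord3/= !crossing_prob_sub !natrD.
have z (x : nat) : (x - x.+1 = 0)%N by lia.
have : M%:R != 0 :> R by rewrite pnatr_eq0.
by rewrite !z !mul0n; move: (M%:R) => r r0; field.
Qed.

Lemma avg_avg_triangle_kernel : avg (fun S => avg (triangle_kernel S)) = 9 * mean_crossing_prob.
Proof.
have p (i j : 'I_3) : i != j -> avg (fun S => crossing_prob (S i - S j)) = mean_crossing_prob.
  move=> ij; rewrite (@avg_coord2 _ _ _ Mgt0 i j (fun x y => crossing_prob (x - y)))//.
  under eq_avg => x do rewrite (avg_sub x crossing_prob).
  by rewrite avg_cst.
under eq_avg => S do rewrite avg_triangle_kernel.
by rewrite avgZ !avgD !p//; ring.
Qed.

(** The average of [crossing_prob (x - y)] over [y] does not depend on [x]: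
    hence the contributions of two edges that share a vertex are uncorrelated. *)
Lemma avg_triangle_kernel_sqr :
  avg (fun S => avg (triangle_kernel S) ^+ 2) = 27 * mean_sqr_crossing_prob + 54 * mean_crossing_prob ^+ 2.
Proof.
pose q (i j : 'I_3) S := crossing_prob (S i - S j).
have sq (i j : 'I_3) : i != j -> avg (fun S => q i j S ^+ 2) = mean_sqr_crossing_prob.
  move=> ij; rewrite (@avg_coord2 _ _ _ Mgt0 i j (fun x y => crossing_prob (x - y) ^+ 2))//.
  under eq_avg => x do rewrite (avg_sub x (fun d => crossing_prob d ^+ 2)).
  by rewrite avg_cst.
have cross (i j l : 'I_3) : i != j -> i != l -> j != l ->
    avg (fun S => q i j S * q i l S) = mean_crossing_prob ^+ 2.
  move=> ij il jl; rewrite -(avg_upd Mgt0 l) /q.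
  under eq_avg => S.
    under eq_avg => a do rewrite upd_same !updE (negbTE il) (negbTE jl).
    rewrite avgZ avg_sub -/mean_crossing_prob.
    over.
  rewrite avgZr (@avg_coord2 _ _ _ Mgt0 i j (fun x y => crossing_prob (x - y)))//.
  under eq_avg => x do rewrite (avg_sub x crossing_prob).
  by rewrite avg_cst.
have qC i j S : q i j S = q j i S by exact: crossing_probC.
under eq_avg => S do rewrite avg_triangle_kernel -/(q 0 1 S) -/(q 0 2 S) -/(q 1 2 S).
transitivity (avg (fun S => 9 * (q 0 1 S ^+ 2 + q 0 2 S ^+ 2 + q 1 2 S ^+ 2) +
  18 * (q 0 1 S * q 0 2 S + q 1 0 S * q 1 2 S + q 2 0 S * q 2 1 S))).
  by apply: eq_avg => S; rewrite (qC 1 0) (qC 2 0) (qC 2 1); ring.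
by rewrite avgD !avgZ !avgD !sq// !cross//; ring.
Qed.

End RandomTriangles.

(** * From independent positions to a uniform permutation *)

Section OrderPatterns.
Context {R : realType} (N M : nat).
Hypothesis M0 : (0 < #|'I_M|)%N.

Lemma injective_rank (y : 'I_N -> nat) : injective y ->
  exists r : 'S_N, forall u v, (r u < r v)%N = (y u < y v)%N.
Proof.
move=> yI; pose rk (u : 'I_N) := #|[pred v : 'I_N | (y v < y u)%N]|.
have rk_lt (u v : 'I_N) : (y u < y v)%N -> (rk u < rk v)%N.
  move=> uv; apply: proper_card; apply/fintype.properP; split.
    by apply/fintype.subsetP => t; rewrite !inE => /ltn_trans; apply.
  by exists u; rewrite inE/= ?ltnn.
have rkN (u : 'I_N) : (rk u < N)%N.
  rewrite -[ltnRHS]card_ord; apply: proper_card; apply/fintype.properP.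
  by split; [apply/fintype.subsetP => t | exists u; rewrite ?inE/= ?ltnn].
have rkI : injective (fun u => Ordinal (rkN u)).
  move=> u v /(congr1 val)/= uv; apply: yI.
  by case: (ltngtP (y u) (y v)) => // /rk_lt; rewrite uv ltnn.
exists (perm rkI) => u v; rewrite !permE/=.
case: (ltngtP (y u) (y v)) => [/rk_lt//|/rk_lt vu|/yI->]; last by rewrite ltnn.
by apply/negbTE; rewrite -leqNgt ltnW.
Qed.

Variable Psi : ('I_N -> nat) -> R.
Hypothesis Psi_order : forall x y : 'I_N -> nat,
  (forall u v, (x u < x v)%N = (y u < y v)%N) -> Psi x = Psi y.

Let perm_avg := avg (fun p : 'S_N => Psi (fun u => p u)).

(** Only the ranks of [y] matter, and composing the relabelling with the rank
    permutation is a bijection of the symmetric group. *)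
Lemma avg_relabel_injective (y : 'I_N -> nat) : injective y ->
  avg (fun p : 'S_N => Psi (fun u => y (p u))) = perm_avg.
Proof.
move=> yI; have [r rE] := injective_rank yI.
have bij : bijective (fun p : 'S_N => p * r)%g.
  by exists (fun p => p * r^-1)%g => p; [rewrite mulgK | rewrite mulgKV].
rewrite /perm_avg [RHS](reindex_avg _ bij); apply: eq_avg => p /=.
by apply: Psi_order => u v; rewrite !permM rE.
Qed.

Let inj (w : {ffun 'I_N -> 'I_M}) : R := (injectiveb w)%:R.

(** Relabelling preserves the uniform distribution of the configurations, so
    that [Psi] may be averaged over all relabellings. *)
Lemma avg_injective_configuration :
  avg (fun w : {ffun 'I_N -> 'I_M} => inj w * Psi (fun u => w u)) = avg inj * perm_avg.
Proof.
have relabel (p : 'S_N) : avg (fun w : {ffun 'I_N -> 'I_M} => inj w * Psi (fun u => w u)) =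
    avg (fun w : {ffun 'I_N -> 'I_M} => inj w * Psi (fun u => w (p u))).
  have bij : bijective (fun w : {ffun 'I_N -> 'I_M} => [ffun u => w (p u)]).
    exists (fun w : {ffun 'I_N -> 'I_M} => [ffun u => w ((p^-1)%g u)]) => w.
      by apply/ffunP => u; rewrite !ffunE permKV.
    by apply/ffunP => u; rewrite !ffunE permK.
  rewrite (reindex_avg _ bij); apply: eq_avg => w /=; congr (_ * _).
    congr (nat_of_bool _)%:R; apply/injectiveP/injectiveP => wI u v.
      by have := wI ((p^-1)%g u) ((p^-1)%g v); rewrite !ffunE !permKV => h /h/perm_inj.
    by rewrite !ffunE => /wI/perm_inj.
  by apply: Psi_order => u v; rewrite !ffunE.
have perm0 : (0 < #|{: 'S_N}|)%N by rewrite -cardsT; apply: cardG_gt0.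
rewrite -[LHS](avg_cst perm0).
under eq_avg => p do rewrite (relabel p).
rewrite exchange_avg -avgZr; apply: eq_avg => w; rewrite avgZ.
rewrite /inj; case: injectiveP => [wI|]; last by rewrite !mul0r.
by rewrite !mul1r (avg_relabel_injective (y := fun u => w u))// => u v /val_inj/wI.
Qed.

(** Union bound over the pairs of equal positions. *)
Lemma avg_non_injective : 1 - avg inj <= N%:R ^+ 2 / M%:R.
Proof.
have W0 := @card_ffun_gt0 'I_N _ M0.
have Mn0 : M%:R != 0 :> R by move: M0; rewrite card_ord pnatr_eq0 -lt0n.
have -> : 1 - avg inj = avg (fun w => 1 - inj w) by rewrite avgB avg_cst.
apply: (@le_trans _ _ (avg (fun w : {ffun 'I_N -> 'I_M} =>
    \sum_u \sum_(v | v != u) (w u == w v)%:R))).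
  apply: ler_avg => w; rewrite /inj.
  have s0 u : 0 <= \sum_(v | v != u) (w u == w v)%:R :> R by exact: sumr_ge0.
  case: injectiveP => [_|ninj]; first by rewrite subrr sumr_ge0.
  have /existsP[u /existsP[v /andP[vu wuv]]] :
      [exists u, exists v, (v != u) && (w u == w v)].
    apply: contraPT (ninj) => /existsPn h; case=> u v wuv.
    apply/eqP; rewrite eq_sym; apply: contraT => vu.
    by have /existsPn/(_ v) := h u; rewrite vu wuv eqxx.
  rewrite subr0 (bigD1 u)//= (bigD1 v)//= wuv -addrA lerDl addr_ge0//.
    by apply: sumr_ge0 => *.
  by apply: sumr_ge0.
rewrite avg_sum.
have coll (u v : 'I_N) : v != u ->
    avg (fun w : {ffun 'I_N -> 'I_M} => (w u == w v)%:R) = M%:R^-1 :> R.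
  move=> vu; rewrite (@avg_coord2 _ _ _ M0 u v (fun a b => (a == b)%:R)) 1?eq_sym//.
  under eq_avg => a.
    have -> : avg (fun b => (a == b)%:R) = M%:R^-1 :> R.
      rewrite /avg (bigD1 a)//= eqxx big1 ?addr0 ?card_ord ?mul1r// => b.
      by rewrite eq_sym => /negbTE->.
    over.
  by rewrite avg_cst.
under eq_bigr => u _.
  rewrite avg_sum; under eq_bigr => v vu do rewrite coll//.
  rewrite sum_neq_cst.
  over.
rewrite sum_cst !card_ord [leLHS]mulrA expr2 ler_wpM2r ?invr_ge0// ler_wpM2l// gerBl//.
Qed.

Lemma avg_configuration_approx B : (forall x, `|Psi x| <= B) ->
  `|avg (fun w : {ffun 'I_N -> 'I_M} => Psi (fun u => w u)) - perm_avg|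
    <= 2 * B * (N%:R ^+ 2 / M%:R).
Proof.
move=> PsiB.
have W0 := @card_ffun_gt0 'I_N _ M0.
have perm0 : (0 < #|{: 'S_N}|)%N by rewrite -cardsT; apply: cardG_gt0.
have B0 : 0 <= B by apply: le_trans (PsiB (fun=> 0%N)).
have paB : `|perm_avg| <= B.
  by apply: le_trans (ler_norm_avg _) _; apply: avg_le.
have inj1 w : 0 <= 1 - inj w by rewrite subr_ge0 /inj lern1 leq_b1.
have -> : avg (fun w : {ffun 'I_N -> 'I_M} => Psi (fun u => w u)) - perm_avg =
    avg (fun w : {ffun 'I_N -> 'I_M} => Psi (fun u => w u) * (1 - inj w)) - perm_avg * avg (fun w => 1 - inj w).
  under [X in _ = X - _]eq_avg => w do rewrite mulrBr mulr1 [X in _ - X]mulrC.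
  by rewrite !avgB avg_cst// avg_injective_configuration; ring.
apply: le_trans (ler_normB _ _) _.
have e : avg (fun w => 1 - inj w) <= N%:R ^+ 2 / M%:R.
  by rewrite avgB avg_cst//; exact: avg_non_injective.
have e0 : 0 <= avg (fun w => 1 - inj w) by exact: avg_ge0.
have h1 : `|avg (fun w : {ffun 'I_N -> 'I_M} => Psi (fun u => w u) * (1 - inj w))| <=
    B * avg (fun w => 1 - inj w).
  apply: le_trans (ler_norm_avgM _ _) _; first by move=> w; exact: PsiB.
  by under eq_avg => w do rewrite ger0_norm//.
have h2 : `|perm_avg * avg (fun w => 1 - inj w)| <= B * avg (fun w => 1 - inj w).
  by rewrite normrM (ger0_norm e0) ler_wpM2r.
have := ler_wpM2l B0 e; lra.
Qed.

End OrderPatterns.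

(** Positions indexed by pairs, so that a block of [k] vertices is one
    coordinate of the product space. *)
Section GroupedPatterns.
Context {R : realType} (n k m : nat) (N : nat) (f : 'I_n * 'I_k -> 'I_N).
Hypothesis f_bij : bijective f.
Variable Psi : ('I_n -> 'I_k -> nat) -> R.
Hypothesis Psi_order : forall x y : 'I_n -> 'I_k -> nat,
  (forall i a j b, (x i a < x j b)%N = (y i a < y j b)%N) -> Psi x = Psi y.

Lemma avg_grouped_approx B : (forall x, `|Psi x| <= B) ->
  `|avg (fun w : {ffun 'I_n -> {ffun 'I_k -> 'I_m.+2}} => Psi (fun i a => w i a))
    - avg (fun p : 'S_N => Psi (fun i a => p (f (i, a))))|
  <= 2 * B * (N%:R ^+ 2 / m.+2%:R).
Proof.
move=> PsiB; have [finv fK finvK] := f_bij.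
have bij : bijective (fun w : {ffun 'I_N -> 'I_m.+2} =>
    [ffun i => [ffun a => w (f (i, a))]] : {ffun 'I_n -> {ffun 'I_k -> 'I_m.+2}}).
  exists (fun w : {ffun 'I_n -> {ffun 'I_k -> 'I_m.+2}} =>
      [ffun u => w (finv u).1 (finv u).2]) => w.
    by apply/ffunP => u; rewrite !ffunE -surjective_pairing finvK.
  by apply/ffunP => i; apply/ffunP => a; rewrite !ffunE fK.
rewrite (reindex_avg _ bij).
have M0 : (0 < #|'I_m.+2|)%N by rewrite card_ord.
set a1 := avg _.
have -> : a1 = avg (fun w : {ffun 'I_N -> 'I_m.+2} => Psi (fun i a => w (f (i, a)))).
  by apply: eq_avg => w; apply: Psi_order => *; rewrite !ffunE.
apply: (avg_configuration_approx M0 (Psi := fun x => Psi (fun i a => x (f (i, a))))) => //.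
by move=> x y xy; apply: Psi_order => *; exact: xy.
Qed.

End GroupedPatterns.

(** * Refining the grid of positions *)

Section GridLimit.
Context {R : realType}.

Lemma cvg_grid : (fun m : nat => m.+2%:R^-1 : R) @ \oo --> (0 : R).
Proof. by have := @cvg_harmonic R; rewrite -cvg_shiftS. Qed.

Lemma cvg_of_dist (u : nat -> R) L C :
  (forall m, `|u m - L| <= C * m.+2%:R^-1) -> u @ \oo --> L.
Proof.
move=> uL; apply: (@cvg_sub0 _ _ _ _ _ _ (cst L)); last exact: cvg_cst.
apply: norm_cvg0.
apply: (@squeeze_cvgr _ _ _ _ (cst 0) (fun m => C * m.+2%:R^-1)).
- by apply: nearW => m /=; rewrite normr_ge0; exact: uL.
- exact: cvg_cst.
- by rewrite -[X in _ --> X](mulr0 C); apply: cvgM; [exact: cvg_cst|exact: cvg_grid].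
Qed.

Lemma cvg_grid_horner (p : {poly R}) (u : nat -> R) :
  (forall m, u m = p.[m.+2%:R^-1]) -> u @ \oo --> p.[0].
Proof.
move=> up; have -> : u = (fun x => p.[x]) \o (fun m => m.+2%:R^-1).
  by apply/funext => m; rewrite up.
by apply: continuous_cvg; [exact: continuous_horner | exact: cvg_grid].
Qed.

Let sum_crossing1 (N : nat) (K : R) :
  \sum_(e < N) e%:R * (K - e%:R) =
  K * (N%:R * (N%:R - 1)) / 2 - (N%:R - 1) * N%:R * (2 * N%:R - 1) / 6.
Proof.
elim: N => [|N IH]; first by rewrite big_ord0; ring.
by rewrite big_ord_recr/= IH -[N.+1]addn1 natrD; field.
Qed.

Let sum_crossing2 (N : nat) (K : R) :
  \sum_(e < N) (e%:R * (K - e%:R)) ^+ 2 =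
  K ^+ 2 * ((N%:R - 1) * N%:R * (2 * N%:R - 1) / 6)
  - 2 * K * (N%:R * (N%:R - 1) / 2) ^+ 2
  + (N%:R - 1) * N%:R * (2 * N%:R - 1) * (3 * N%:R ^+ 2 - 3 * N%:R - 1) / 30.
Proof.
elim: N => [|N IH]; first by rewrite big_ord0; field.
by rewrite big_ord_recr/= IH -[N.+1]addn1 natrD; field.
Qed.

Let crossing_probE m (F : R -> R) : F 0 = 0 ->
  \sum_(d < m.+2) F (crossing_prob d) =
  \sum_(e < m.+1) F (e%:R * (m%:R - e%:R) / m.+2%:R ^+ 2).
Proof.
move=> F0; rewrite big_ord_recl /crossing_prob/= mul0n mul0r F0 add0r.
apply: eq_bigr => e _; congr (F (_ / _)).
rewrite /bump/= add1n subSS natrM natrB//.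
by have := ltn_ord e; rewrite ltnS.
Qed.

Lemma cvg_mean_crossing_prob : @mean_crossing_prob R @ \oo --> (6^-1 : R).
Proof.
pose p : {poly R} := 6^-1%:P * ((1 - 2%:P * 'X) ^+ 3 - (1 - 2%:P * 'X) * 'X ^+ 2).
have -> : 6^-1 = p.[0] by rewrite /p !hornerE/=; field.
apply: cvg_grid_horner => m; rewrite {}/p.
rewrite !hornerE /mean_crossing_prob /avg card_ord (@crossing_probE m id)// -mulr_suml sum_crossing1.
have -> : m.+1%:R = m%:R + 1 :> R by rewrite -natr1.
have -> : m%:R = m.+2%:R - 2 :> R by rewrite -addn2 natrD; ring.
have : m.+2%:R != 0 :> R by rewrite pnatr_eq0.
by move: (m.+2%:R : R) => M M0 /=; field.
Qed.

Lemma cvg_mean_sqr_crossing_prob : @mean_sqr_crossing_prob R @ \oo --> (30^-1 : R).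
Proof.
pose p : {poly R} := 30^-1%:P * ((1 - 2%:P * 'X) ^+ 5 - (1 - 2%:P * 'X) * 'X ^+ 4).
have -> : 30^-1 = p.[0] by rewrite /p !hornerE/=; field.
apply: cvg_grid_horner => m; rewrite {}/p.
rewrite !hornerE /mean_sqr_crossing_prob /avg card_ord (@crossing_probE m (fun x => x ^+ 2)) ?expr0n//.
under eq_bigr do rewrite expr_div_n.
rewrite -mulr_suml sum_crossing2.
have -> : m.+1%:R = m%:R + 1 :> R by rewrite -natr1.
have -> : m%:R = m.+2%:R - 2 :> R by rewrite -addn2 natrD; ring.
have : m.+2%:R != 0 :> R by rewrite pnatr_eq0.
by move: (m.+2%:R : R) => M M0 /=; field.
Qed.

End GridLimit.

(** * Two triangles on six points *)

Section SixPoints.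

(** Big operators do not reduce, hence the same count with explicit sums. *)
Let sum3 (g : nat -> nat) := (g 0 + (g 1 + g 2))%N.

Let cross_count (s : nat -> nat) (a b : nat) :=
  sum3 (fun k => sum3 (fun l => sum3 (fun k' => sum3 (fun l' =>
    [&& s (b + k') < s (a + k), s (a + l) < s (b + k') & s (b + l') < s (a + l)]))))%N.

Let triangle_cross_count (s : nat -> nat) (a b : nat) :
  triangle_cross (fun k => s (a + k)%N) (fun k => s (b + k)%N) = cross_count s a b.
Proof. by rewrite /triangle_cross !big_ord3/=. Qed.

(** Trades a sum over permutations for a sum over lists, which computes. *)
Lemma sum_perm (N : nat) (F : seq nat -> nat) :
  (\sum_(p : 'S_N) F [seq val (p i) | i <- enum 'I_N] =
   sumn [seq F s | s <- permutations (iota 0 N)])%N.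
Proof.
pose h (p : 'S_N) := [seq val (p i) | i <- enum 'I_N].
have hI : injective h.
  move=> p q /eq_in_map pq; apply/permP => i; apply: val_inj.
  by apply: pq; rewrite mem_enum.
have hu : uniq [seq h p | p <- enum {: 'S_N}] by rewrite map_inj_uniq//; exact: enum_uniq.
have hs : {subset [seq h p | p <- enum {: 'S_N}] <= permutations (iota 0 N)}.
  move=> _ /mapP[p _ ->]; rewrite mem_permutations.
  apply: uniq_perm; rewrite ?iota_uniq//.
    rewrite map_inj_uniq; first exact: enum_uniq.
    by move=> i j /val_inj/perm_inj.
  move=> j; rewrite mem_iota/= add0n; apply/mapP/idP => [[i _ ->]|jN].
    exact: ltn_ord.
  by exists ((p^-1)%g (Ordinal jN)); rewrite ?mem_enum// permKV.
have sz : (size (permutations (iota 0 N)) <= size [seq h p | p <- enum {: 'S_N}])%N.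
  rewrite size_permutations ?iota_uniq// size_iota size_map -cardE.
  by rewrite card_Sn.
have [_ hE] := uniq_min_size hu hs sz.
have pe : perm_eq [seq h p | p <- enum {: 'S_N}] (permutations (iota 0 N)).
  by apply: uniq_perm => //; exact: permutations_uniq.
rewrite sumnE big_map -(perm_big _ pe) big_map big_enum.
by [].
Qed.

Lemma six_points_second_moment :
  (\sum_(p : 'S_6) triangle_crossings (fun k => p (inord k)) (fun k => p (inord (3 + k))) ^ 2
   = 9504)%N.
Proof.
pose F (s : seq nat) := ((cross_count (nth 0%N s) 0 3 + cross_count (nth 0%N s) 3 0) ^ 2)%N.
transitivity (\sum_(p : 'S_6) F [seq val (p i) | i <- enum 'I_6])%N.
  apply: eq_bigr => p _; rewrite /F -!triangle_cross_count.
  have E (a : nat) (k : 'I_3) : (a <= 3)%N ->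
      nth 0%N [seq val (p i) | i <- enum 'I_6] (a + k) = p (inord (a + k)).
    move=> a3; have ak : (a + k < 6)%N by have := ltn_ord k; lia.
    rewrite (nth_map ord0) ?size_enum_ord//; congr (val (p _)).
    by apply: val_inj; rewrite /= nth_enum_ord// inordK.
  congr (_ ^ 2)%N; congr (_ + _)%N; rewrite /triangle_cross;
  do 4 (apply: eq_bigr => ? _); by rewrite !E// add0n.
rewrite sum_perm.
by vm_compute.
Qed.

End SixPoints.

(** * The number of crossings of disjoint triangles *)

Definition crossings (n : nat) (x : 'I_n -> 'I_3 -> nat) : nat :=
  (\sum_i \sum_(j | j != i) triangle_cross (x i) (x j))%N.

Lemma triangle_cross_order (S T S' T' : 'I_3 -> nat) :
  (forall a b, (S a < T b)%N = (S' a < T' b)%N) ->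
  (forall a b, (T b < S a)%N = (T' b < S' a)%N) ->
  triangle_cross S T = triangle_cross S' T'.
Proof.
move=> ST TS; rewrite /triangle_cross.
by do 4 (apply: eq_bigr => ? _); rewrite !ST !TS.
Qed.

Lemma triangle_crossings_order (S T S' T' : 'I_3 -> nat) :
  (forall a b, (S a < T b)%N = (S' a < T' b)%N) ->
  (forall a b, (T b < S a)%N = (T' b < S' a)%N) ->
  triangle_crossings S T = triangle_crossings S' T'.
Proof.
move=> ST TS; rewrite /triangle_crossings (triangle_cross_order ST TS).
by rewrite (triangle_cross_order (fun a b => TS b a) (fun a b => ST b a)).
Qed.

Lemma crossings_order (n : nat) (x y : 'I_n -> 'I_3 -> nat) :
  (forall i a j b, (x i a < x j b)%N = (y i a < y j b)%N) ->
  crossings x = crossings y.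
Proof.
move=> xy; apply: eq_bigr => i _; apply: eq_bigr => j _.
by apply: triangle_cross_order => a b; rewrite xy.
Qed.

Lemma crossings_le (n : nat) (x : 'I_n -> 'I_3 -> nat) : (crossings x <= n * (n * 6))%N.
Proof.
rewrite -[X in (_ <= X * _)%N](card_ord n) -sum_nat_const; apply: leq_sum => i _.
rewrite -[X in (_ <= X * _)%N](card_ord n) -sum_nat_const big_mkcond.
apply: leq_sum => j _; case: ifP => // _.
exact: leq_trans (leq_addr _ _) (triangle_crossings_le6 (x i) (x j)).
Qed.

Lemma ustat_triangle_kernel (R : realType) (n m : nat)
    (w : {ffun 'I_n -> {ffun 'I_3 -> 'I_m.+2}}) :
  ustat (@triangle_kernel R m) w = (crossings (fun i a => w i a))%:R.
Proof.
rewrite /ustat /triangle_kernel /triangle_crossings.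
pose t i j : R := (triangle_cross (fun k => w i k) (fun k => w j k))%:R.
have -> : (crossings (fun i a => w i a))%:R = \sum_i \sum_(j | j != i) t i j.
  by rewrite natr_sum; apply: eq_bigr => i _; rewrite natr_sum.
have sym : \sum_i \sum_(j | j != i) t j i = \sum_i \sum_(j | j != i) t i j.
  rewrite [RHS](exchange_big_dep predT)//=; apply: eq_bigr => i _.
  by apply: eq_bigl => j; rewrite eq_sym.
transitivity (\sum_i \sum_(j | j != i) (t i j + t j i) / 2).
  by apply: eq_bigr => i _; apply: eq_bigr => j _; rewrite natrD.
under eq_bigr => i _ do rewrite -mulr_suml big_split/=.
by rewrite -mulr_suml big_split/= sym; field.
Qed.

Section CrossingsOfRandomPermutation.
Context {R : realType} (n N : nat) (f : 'I_n * 'I_3 -> 'I_N).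
Hypothesis f_bij : bijective f.

Let X (p : 'S_N) : R := (crossings (fun i a => p (f (i, a))))%:R.
Let U m (w : {ffun 'I_n -> {ffun 'I_3 -> 'I_m.+2}}) := ustat (@triangle_kernel R m) w.
Arguments U : clear implicits.

Let perm0 : (0 < #|{: 'S_N}|)%N. Proof. by rewrite -cardsT; apply: cardG_gt0. Qed.

Let A0 m : (0 < #|{ffun 'I_3 -> 'I_m.+2}|)%N.
Proof. by apply: card_ffun_gt0; rewrite card_ord. Qed.

(** The statistic takes finitely many values, which bounds [h] on its range. *)
Let cvg_statistic (h : R -> R) :
  (fun m => avg (fun w => h (U m w))) @ \oo --> avg (fun p => h (X p)).
Proof.
pose B : R := \sum_(c < (n * (n * 6)).+1) `|h c%:R|.
pose Psi (x : 'I_n -> 'I_3 -> nat) := h (crossings x)%:R.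
apply: (@cvg_of_dist _ _ _ (2 * B * N%:R ^+ 2)) => m.
under [X in `|X - _|]eq_avg => w do rewrite /U ustat_triangle_kernel.
rewrite -[leRHS]mulrA; apply: (@avg_grouped_approx R _ _ _ _ _ f_bij Psi).
  by move=> x y xy; rewrite /Psi (crossings_order xy).
move=> x; have xB : (crossings x < (n * (n * 6)).+1)%N by rewrite ltnS crossings_le.
by rewrite /B (bigD1 (Ordinal xB))//= lerDl; apply: sumr_ge0.
Qed.

Let mu := avg X.

Let cvg_variance :
  (fun m => avg (fun w => (U m w - avg (U m)) ^+ 2)) @ \oo -->
  avg (fun p => (X p - mu) ^+ 2).
Proof.
rewrite avg_sqr_ge0B//.
have -> : (fun m => avg (fun w => (U m w - avg (U m)) ^+ 2)) =
    (fun m => avg (fun w => U m w ^+ 2)) - (fun m => avg (U m)) * (fun m => avg (U m)).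
  apply/funext => m; rewrite avg_sqr_ge0B; last exact: card_ffun_gt0.
  by rewrite [avg (U m) ^+ 2]expr2.
rewrite [mu ^+ 2]expr2.
apply: cvgB; first exact: (@cvg_statistic (fun x => x ^+ 2)).
by apply: cvgM; exact: (@cvg_statistic id).
Qed.

(** The limit is [9504 / (4 * 720)]. *)
Lemma cvg_kernel_second_moment :
  (fun m => avg (fun S => avg (fun T => @triangle_kernel R m S T ^+ 2))) @ \oo
  --> (33 / 10 : R).
Proof.
pose g (q : 'I_2 * 'I_3) : 'I_6 := inord (3 * q.1 + q.2).
have gv q : g q = (3 * q.1 + q.2)%N :> nat.
  by rewrite inordK//; have := ltn_ord q.1; have := ltn_ord q.2; lia.
have g_bij : bijective g.
  apply: inj_card_bij; last by rewrite card_prod !card_ord.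
  move=> [i a] [j b] /(congr1 (@nat_of_ord 6)); rewrite !gv/= => E.
  have := ltn_ord a; have := ltn_ord b => ? ?.
  by congr (_, _); apply: val_inj => /=; lia.
pose Psi (x : 'I_2 -> 'I_3 -> nat) : R :=
  ((triangle_crossings (x ord0) (x ord_max))%:R / 2) ^+ 2.
have P9 x : `|Psi x| <= 9.
  have h6 : ((triangle_crossings (x ord0) (x ord_max))%:R : R) <= 6.
    by rewrite ler_nat triangle_crossings_le6.
  have h0 := ler0n R (triangle_crossings (x ord0) (x ord_max)).
  rewrite ger0_norm ?sqr_ge0// /Psi (_ : 9 = 3 ^+ 2); last by ring.
  by rewrite lerXn2r ?nnegrE// ?divr_ge0// ler_pdivrMr//; lra.
have -> : 33 / 10 = avg (fun p : 'S_6 => Psi (fun i a => p (g (i, a)))).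
  have -> : avg (fun p : 'S_6 => Psi (fun i a => p (g (i, a)))) =
    (\sum_(p : 'S_6) triangle_crossings (fun k => p (inord k))
       (fun k => p (inord (3 + k))) ^ 2)%N%:R / (4 * 720).
    have -> : (4 * 720)%R = 2 ^+ 2 * #|{: 'S_6}|%:R :> R.
      by rewrite card_Sn (_ : 6`! = 720)%N//; ring.
    rewrite invfM mulrA /avg; congr (_ / _).
    rewrite natr_sum mulr_suml; apply: eq_bigr => p _.
    rewrite /Psi expr_div_n natrX; congr (_%:R ^+ 2 / _).
  by rewrite six_points_second_moment; field.
apply: (@cvg_of_dist _ _ _ (2 * 9 * 6 ^+ 2)) => m.
have -> : avg (fun S => avg (fun T => @triangle_kernel R m S T ^+ 2)) =
    avg (fun w : {ffun 'I_2 -> {ffun 'I_3 -> 'I_m.+2}} => Psi (fun i a => w i a)).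
  by rewrite -(@avg_coord2 R 'I_2 _ (A0 m) ord0 ord_max (fun S T => @triangle_kernel R m S T ^+ 2)).
rewrite -[leRHS]mulrA; apply: (@avg_grouped_approx R _ _ _ _ _ g_bij Psi) => //.
move=> x y xy; rewrite /Psi.
by rewrite (@triangle_crossings_order _ _ (y ord0) (y ord_max)).
Qed.

(** Both sides are limits of the variance for independent positions, which
    [ustat_variance] expresses with the three moments whose limits are known. *)
Lemma crossings_variance : avg (fun p => (X p - mu) ^+ 2) =
  3 * n%:R ^+ 3 / 5 + 3 * n%:R ^+ 2 / 10 - 9 * n%:R / 10.
Proof.
apply: (cvg_unique _ cvg_variance) => //.
pose v m := avg (fun S => avg (fun T => @triangle_kernel R m S T ^+ 2)).
pose c1 : R := 2 * n%:R * (n%:R - 1).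
pose c2 : R := 4 * n%:R * (n%:R - 1) * (n%:R - 2).
have -> : (fun m => avg (fun w => (U m w - avg (U m)) ^+ 2)) =
    (fun m => c1 * (v m - 81 * (@mean_crossing_prob R m * @mean_crossing_prob R m))
              + c2 * (27 * @mean_sqr_crossing_prob R m - 27 * (@mean_crossing_prob R m * @mean_crossing_prob R m))).
  apply/funext => m; rewrite /U ustat_variance//; last exact: triangle_kernelC.
  rewrite card_ord avg_avg_triangle_kernel avg_triangle_kernel_sqr.
  by rewrite /c1 /c2 /v; ring.
have -> : 3 * n%:R ^+ 3 / 5 + 3 * n%:R ^+ 2 / 10 - 9 * n%:R / 10 =
  c1 * (33 / 10 - 81 * (6^-1 * 6^-1)) + c2 * (27 * 30^-1 - 27 * (6^-1 * 6^-1)) :> R.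
  by rewrite /c1 /c2; field.
have mm := cvgM (@cvg_mean_crossing_prob R) (@cvg_mean_crossing_prob R).
have cm (c l : R) (u : nat -> R) : u @ \oo --> l -> (fun m => c * u m) @ \oo --> c * l.
  by move=> ul; apply: cvgM => //; exact: cvg_cst.
apply: cvgD; apply: (cm); apply: cvgB.
- exact: cvg_kernel_second_moment.
- by apply: (cm); exact: mm.
- by apply: (cm); exact: cvg_mean_sqr_crossing_prob.
- by apply: (cm); exact: mm.
Qed.

(** For independent positions the theorem for U-statistics applies with [H = 3]
    and, as the limit variance exceeds [n ^ 3 / 2] for [2 <= n], with
    [kappa = 1/2] once the grid is fine enough.  The resulting bound does not
    depend on the grid, and [2448 = 136 * 9 * 2]. *)
Lemma crossings_berry_esseen t : (2 <= n)%N ->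
  `|avg (fun p => (X p <= t)%R%:R) -
    gauss_cdf ((t - mu) / Num.sqrt (avg (fun p => (X p - mu) ^+ 2)))|
  <= 2448 / Num.sqrt n%:R.
Proof.
move=> n2; set s := Num.sqrt (avg _).
pose V := avg (fun p => (X p - mu) ^+ 2).
pose Vm m := avg (fun w => (U m w - avg (U m)) ^+ 2).
have nR : 2 <= n%:R :> R by rewrite ler_nat.
have Vlow : 2^-1 * n%:R ^+ 3 < V.
  by rewrite /V crossings_variance; nra.
have V0 : 0 < V by apply: le_lt_trans Vlow; rewrite mulr_ge0 ?exprn_ge0.
have s0 : s != 0 by rewrite gt_eqF// sqrtr_gt0.
have cs : (fun m => Num.sqrt (Vm m)) @ \oo --> s.
  by apply: continuous_cvg; [exact: sqrt_continuous | exact: cvg_variance].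
have cmu : (fun m => avg (U m)) @ \oo --> mu by exact: (@cvg_statistic id).
have cz : (fun m => (t - avg (U m)) / Num.sqrt (Vm m)) @ \oo --> (t - mu) / s.
  apply: cvgM; first by apply: cvgB => //; exact: cvg_cst.
  exact: cvgV.
have cPhi : (fun m => gauss_cdf ((t - avg (U m)) / Num.sqrt (Vm m))) @ \oo
    --> gauss_cdf ((t - mu) / s).
  apply: continuous_cvg => //.
  by apply/differentiable_continuous/derivable1_diffP; have [] := is_derive_gauss_cdf ((t - mu) / s).
have cF := @cvg_statistic (fun x => (x <= t)%R%:R).
apply: (cvgr_to_le (cvg_norm (cvgB cF cPhi))).
have : \forall m \near \oo, 2^-1 * n%:R ^+ 3 < Vm m by exact: (cvgr_gt V).
apply: filterS => m Vlow_m.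
have V0m : 0 < Vm m by apply: le_lt_trans Vlow_m; rewrite mulr_ge0 ?exprn_ge0.
have s0m : 0 < Num.sqrt (Vm m) by rewrite sqrtr_gt0.
set zm := (t - avg (U m)) / Num.sqrt (Vm m).
change (`|avg (fun w => (U m w <= t)%R%:R) - gauss_cdf zm| <= 2448 / Num.sqrt n%:R).
have -> : avg (fun w => (U m w <= t)%R%:R) =
    avg (fun w => ((U m w - avg (U m)) / Num.sqrt (Vm m) <= zm)%R%:R) :> R.
  by apply: eq_avg => w; rewrite ler_pM2r ?invr_gt0// lerD2r.
have -> : 2448 / Num.sqrt n%:R = 136 * 3 ^+ 2 / (2^-1 * Num.sqrt #|'I_n|%:R) :> R.
  by rewrite card_ord; field; rewrite gt_eqF// sqrtr_gt0 (lt_le_trans _ nR).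
apply: (ustat_berry_esseen (A0 m) (@triangle_kernelC R m)) => //.
- rewrite card_ord; exact: leq_trans n2.
- exact: triangle_kernel_osc.
- by rewrite sqr_sqrtr ?ltW.
- by lra.
- by rewrite card_ord sqr_sqrtr ltW.
Qed.

End CrossingsOfRandomPermutation.

(** * Crossings in an embedding of the graph *)

Section CrossingsOfTriangleGraph.
Variables (n N : nat) (e : rel 'I_N) (f : 'I_n * 'I_3 -> 'I_N).
Hypothesis f_bij : bijective f.
Hypothesis f_edge : forall x y, e (f x) (f y) = (x.1 == y.1) && (x.2 != y.2).

Let sum_vertices (G : 'I_N -> nat) :
  (\sum_u G u = \sum_i \sum_k G (f (i, k)))%N.
Proof.
rewrite (reindex f)/=; last exact: onW_bij.
by rewrite [RHS]pair_bigA; apply: eq_bigr => -[].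
Qed.

Let sum_neighbours i k (G : 'I_N -> nat) :
  (\sum_u e (f (i, k)) u * G u = \sum_l (k != l) * G (f (i, l)))%N.
Proof.
rewrite sum_vertices (bigD1 i)//= [X in (_ + X)%N]big1 ?addn0.
  by apply: eq_bigr => l _; rewrite f_edge eqxx.
by move=> j ji; apply: big1 => l _; rewrite f_edge/= eq_sym (negbTE ji).
Qed.

(** A crossing quadruple consists of an edge of a triangle [i] and an edge of a
    triangle [j], and [i != j] by [triangle_cross_self]. *)
Lemma nb_crossingsE (p : 'S_N) :
  nb_crossings e p = crossings (fun i a => p (f (i, a))).
Proof.
pose ineq (a b c d : 'I_N) : nat := [&& p c < p a, p b < p c & p d < p b]%N.
have -> : nb_crossings e p =
    (\sum_a \sum_b e a b * \sum_c \sum_d e c d * ineq a b c d)%N.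
  have -> : (\sum_a \sum_b e a b * \sum_c \sum_d e c d * ineq a b c d =
      \sum_a \sum_b \sum_c \sum_d is_crossing e p (a, b, c, d))%N.
    apply: eq_bigr => a _; apply: eq_bigr => b _; rewrite big_distrr/=.
    apply: eq_bigr => c _; rewrite big_distrr/=; apply: eq_bigr => d _.
    by rewrite /is_crossing /ineq -!mulnb.
  rewrite pair_bigA/= pair_bigA/= pair_bigA/= /nb_crossings -sum1_card big_mkcond/=.
  by apply: eq_bigr => -[[[a b] c] d] _ /=; rewrite unfold_in; case: ifP.
have drop (S T : 'I_3 -> nat) k l :
    ((k != l) * (\sum_k' \sum_l' (k' != l') *
       [&& T k' < S k, S l < T k' & T l' < S l]) =
     \sum_k' \sum_l' [&& T k' < S k, S l < T k' & T l' < S l])%N.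
  rewrite big_distrr/=; apply: eq_bigr => k' _; rewrite big_distrr/=.
  apply: eq_bigr => l' _.
  have [<-|_] := eqVneq k l; first by rewrite mul0n; lia.
  have [<-|_] := eqVneq k' l'; last by rewrite !mul1n.
  by rewrite mul0n muln0; lia.
transitivity (\sum_i \sum_j triangle_cross (fun a => p (f (i, a)))
    (fun a => p (f (j, a))))%N; last first.
  apply: eq_bigr => i _; rewrite (bigD1 i)//= triangle_cross_self add0n.
  by [].
rewrite sum_vertices; apply: eq_bigr => i _.
rewrite /triangle_cross [RHS]exchange_big/=; apply: eq_bigr => k _.
rewrite [RHS]exchange_big/= sum_neighbours; apply: eq_bigr => l _.
rewrite sum_vertices big_distrr/=; apply: eq_bigr => j _.
rewrite -(drop (fun a => p (f (i, a))) (fun a => p (f (j, a))) k l).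
congr (_ * _)%N; apply: eq_bigr => k' _; exact: sum_neighbours.
Qed.

End CrossingsOfTriangleGraph.

(** * Transfer to the underlying probability space *)

Section UniformPermutation.
Context d (T : measurableType d) (R : realType) (P : probability T R).
Variables (N : nat) (s : {RV P >-> 'S_N}).
Hypothesis s_unif : uniform_perm s.

Lemma expectation_uniform_perm (h : 'S_N -> R) : (forall p, 0 <= h p) ->
  'E_P[h \o s]%E = (avg h)%:E.
Proof.
move=> h0; rewrite unlock.
transitivity (\int[P]_w \sum_(p : 'S_N) (h p * \1_(s @^-1` [set p]) w)%:E)%E.
  apply: eq_integral => w _; rewrite sumEFin; congr EFin.
  rewrite (bigD1 (s w))//= big1 ?addr0.
    by rewrite indicE mem_set// mulr1.
  by move=> p pw; rewrite indicE memNset ?mulr0// => /= E; rewrite E eqxx in pw.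
have mp (p : 'S_N) : measurable (s @^-1` [set p]).
  by rewrite -[X in measurable X]setTI; exact: measurable_funPT.
rewrite ge0_integral_sum//; last 2 first.
- move=> p; apply/measurable_EFinP; apply: measurable_funM => //.
- by move=> p w _; rewrite lee_fin mulr_ge0.
rewrite /avg mulr_suml -sumEFin; apply: eq_bigr => p _.
under eq_integral => w _ do rewrite EFinM.
rewrite ge0_integralZl//; last 2 first.
- by apply/measurable_EFinP.
- by rewrite lee_fin.
rewrite integral_indic// setIT EFinM; congr (_ * _)%E.
exact: s_unif.
Qed.

Lemma distribution_uniform_perm (h : 'S_N -> R) (Y : {RV P >-> R}) x :
  (forall w, Y w = h (s w)) ->
  cdf Y x = (avg (fun p => (h p <= x)%R%:R))%:E.
Proof.
move=> Yh; rewrite -(expectation_uniform_perm (h := fun p => (h p <= x)%R%:R))//.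
rewrite /cdf /distribution /pushforward -expectation_indic//; last first.
  rewrite -[X in measurable X]setTI; exact: measurable_funPT.
congr (expectation P _); apply/funext => w /=; rewrite indicE; congr ((nat_of_bool _)%:R).
apply/idP/idP; first by rewrite inE/= in_itv/= Yh.
by move=> hx; rewrite inE/= in_itv/= Yh.
Qed.

End UniformPermutation.

Theorem mainTheorem12 (R : realType)
    (d : measure_display) (T : measurableType d) (P : probability T R)
    (d' : measure_display) (T' : measurableType d') (P' : probability T' R)
    (n : nat) (e : rel 'I_(3 * n))
    (he : graph_iso (disjoint_copies n (complete_graph 3)) e)
    (s : {RV P >-> 'S_(3 * n)}) (hs : uniform_perm s)
    (Z : {RV P' >-> R}) (hZ : standard_normal Z) :
  let X : {RV P >-> R} := crossingsRV e s in
  let W : {RV P >-> R} := standardize X in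
  'V_P[X]%E =
    (3 * n%:R ^+ 3 / 5 + 3 * n%:R ^+ 2 / 10 - 9 * n%:R / 10)%:E /\
  ((1 <= n)%N ->
    (kolmogorov_dist W Z <= (3620 / Num.sqrt n%:R)%:E)%E).
Proof.
move=> X W; have [f f_bij f_edge] := he.
pose x (p : 'S_(3 * n)) : R := (crossings (fun i a => p (f (i, a))))%:R.
have XE w : X w = x (s w).
  by rewrite /X/= /crossingsRV (nb_crossingsE f_bij f_edge).
have EX : 'E_P[X]%E = (avg x)%:E.
  rewrite -(expectation_uniform_perm hs); last by move=> p; exact: ler0n.
  by congr (expectation P _); apply/funext => w /=; exact: XE.
have VX : 'V_P[X]%E = (avg (fun p => (x p - avg x) ^+ 2))%:E.
  rewrite -(expectation_uniform_perm hs); last by move=> p; exact: sqr_ge0.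
  rewrite /variance unlock EX/=; congr (expectation P _); apply/funext => w /=.
  by rewrite -XE -expr2.
split; first by rewrite VX (crossings_variance f_bij).
move=> n1; apply: ge_ereal_sup => _ [t _ <-].
have ZE : cdf Z t = (gauss_cdf t)%:E.
  by rewrite /cdf hZ//= /gauss_cdf fineK// fin_num_measure.
pose sd := Num.sqrt (avg (fun p => (x p - avg x) ^+ 2)).
have WE : cdf W t = (avg (fun p => ((x p - avg x) / sd <= t)%R%:R))%:E.
  apply: (distribution_uniform_perm hs (h := fun p => (x p - avg x) / sd)) => w.
  by rewrite /W/= /standardize EX VX/= XE.
rewrite ZE WE -EFinB lee_fin.
have [n2|n2] := leqP 2 n; last first.
  (* for a single triangle the bound exceeds 1 *)
  have -> : n%:R = 1 :> R by rewrite (_ : n = 1%N)//; lia.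
  have /andP[P0 P1] := gauss_cdf_itv t.
  have perm0 : (0 < #|{: 'S_(3 * n)}|)%N by rewrite -cardsT; apply: cardG_gt0.
  have a1 : avg (fun p => ((x p - avg x) / sd <= t)%R%:R) <= 1 :> R.
    by apply: avg_le => // p; rewrite lern1 leq_b1.
  have a0 : 0 <= avg (fun p => ((x p - avg x) / sd <= t)%R%:R) :> R.
    by apply: avg_ge0 => p; exact: ler0n.
  by rewrite sqrtr1 divr1 ler_norml; apply/andP; split; lra.
have nR : 2 <= n%:R :> R by rewrite ler_nat.
have sd0 : 0 < sd by rewrite sqrtr_gt0 (crossings_variance f_bij); nra.
pose u := t * sd + avg x.
have bound : `|avg (fun p => (x p <= u)%R%:R) - gauss_cdf ((u - avg x) / sd)|
    <= 2448 / Num.sqrt n%:R by exact: crossings_berry_esseen f_bij u n2.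
move: bound; rewrite /u addrK mulfK ?gt_eqF//.
have -> : avg (fun p => (x p <= t * sd + avg x)%R%:R) =
    avg (fun p => ((x p - avg x) / sd <= t)%R%:R) :> R.
  by apply: eq_avg => p; rewrite ler_pdivrMr// lerBlDr.
move=> bound; apply: (le_trans bound).
by rewrite ler_wpM2r ?invr_ge0 ?sqrtr_ge0// ler_nat.
Qed.
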